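(* Let $\delta>0$. The Bipartite Iterative Scaling algorithm run with $\epsilon=\frac{\delta}{4|E|\log(d)}$ and stopping threshold $\delta'=\frac{\delta}{8C_\infty}$, followed by the Rounding algorithm applied to its output (both defined in the context), yields a $\delta$-approximate solution to the tree-structured multi-marginal optimal transport problem $$\min_{B_{(j,k)},(j,k)\in E;\ \mu_j,\,j\in V\setminus\Gamma}\ \sum_{(j,k)\in E}\langle C_{(j,k)},B_{(j,k)}\rangle\quad\text{s.t.}\quad B_{(j,k)}\in\mathbb R_+^{d\times d},\ B_{(j,k)}\mathbf 1=\mu_j,\ B_{(j,k)}^\top\mathbf 1=\mu_k\ \text{ for }(j,k)\in E$$ in $T$ arithmetic operations, where $$T=\mathcal O\left(\frac{|E|^3\,C_\infty^2\,d^2\log(d)}{\delta^2}\right).$$ Here a $\delta$-approximate solution is a feasible point whose objective value exceeds the optimal value by at most $\delta$.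
   Context: Setting. $G=(V,E)$ is a finite tree (each undirected edge is counted once in $E$; both orientations $(j,k)$, $(k,j)$ are used as indices), $N(j)$ is the set of neighbours of $j$. $\Gamma\subset V$ is a set of leaves, no two of which are adjacent; for $j\in\Gamma$, $k_j$ is its unique neighbour and $\mu_j\in\mathbb R_+^d$ is a given (fixed) probability vector. $C_{(j,k)}\in\mathbb R^{d\times d}$ are cost matrices with $C_{(k,j)}=C_{(j,k)}^\top$, and $B_{(k,j)}=B_{(j,k)}^\top$; $C_\infty=\max_{(j,k)\in E}\|C_{(j,k)}\|_\infty$ (largest absolute value of an entry). $K_{(j,k)}=\exp(-C_{(j,k)}/\epsilon)$ entrywise, $\gamma_j=\mu_j$ if $j\in\Gamma$ and $\gamma_j=\mathbf 1$ otherwise. $\odot$, $./$ and powers of vectors are entrywise; $\|\cdot\|_1$ is the sum of absolute values of entries; $\langle\cdot,\cdot\rangle$ is the entrywise inner product. Bipartite Iterative Scaling algorithm (parameters $\epsilon,\delta'$). Let $V=S_1\sqcup S_2$ be the bipartition of the tree (every edge joins $S_1$ and $S_2$). Start with $u^0_{(j,k)}=\mathbf 1\in\mathbb R^d$ for every ordered pair of adjacent nodes. At each iteration $t\to t+1$ ($t=0,1,2,\dots$), let $S$ be $S_1$ and $S_2$ alternately, starting with $S_1$. Put $B^t_{(j,k)}=\operatorname{diag}(u^t_{(j,k)}\odot\gamma_j)K_{(j,k)}\operatorname{diag}(u^t_{(k,j)}\odot\gamma_k)$, $q^t_{(j,k)}=B^t_{(j,k)}\mathbf 1$, $q^{t+1}_j=\big(\bigodot_{k\in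 N(j)}q^t_{(j,k)}\big)^{1/|N(j)|}$, and update $u^{t+1}_{(j,k_j)}=u^t_{(j,k_j)}\odot\mu_j\,./\,q^t_{(j,k_j)}$ for $j\in\Gamma\cap S$; $u^{t+1}_{(j,k)}=u^t_{(j,k)}\odot\frac{q^{t+1}_j}{\|q^{t+1}_j\|_1}\,./\,q^t_{(j,k)}$ for $j\in(V\setminus\Gamma)\cap S$, $k\in N(j)$; all other $u$ are unchanged. (At coordinates where $\mu_j$ vanishes, $u^{t+1}_{(j,k_j)}$ is understood as the corresponding entry of $\mathbf 1./(K_{(j,k_j)}u^t_{(k_j,j)})$.) Stop (testing for $t\ge1$) as soon as $\sum_{j\in\Gamma}\|B^t_{(j,k_j)}\mathbf 1-\mu_j\|_1+\sum_{j\in V\setminus\Gamma}\sum_{k\in N(j)}\|q^t_{(j,k)}-\bar q^t_j\|_1\le\delta'$, where $\bar q^t_j=\frac1{|N(j)|}\sum_{k\in N(j)}q^t_{(j,k)}$, and output the matrices $B^t_{(j,k)}$. Rounding algorithm. Input: $\{B_{(j,k)}\}$ as output above, and let $S\in\{S_1,S_2\}$ be the part whose nodes were not updated in the last iteration (the nodes outside $S$ have no marginal mismatch). For $j\in\Gamma\cap S$ replace $B_{(j,k_j)}$ by $\widehat B_{(j,k_j)}=\mathrm{Round}(B_{(j,k_j)};\mu_j,B_{(j,k_j)}^\top\mathbf 1)$. For $j\in S\setminus\Gamma$ and all $k\in N(j)$ replace $B_{(j,k)}$ by $\widehat B_{(j,k)}=\mathrm{Round}(B_{(j,k)};\bar q_j(B),B_{(j,k)}^\top\mathbf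 1)$, with $\bar q_j(B)=\frac1{|N(j)|}\sum_{k\in N(j)}B_{(j,k)}\mathbf 1$. Output $\{\widehat B_{(j,k)}\}$. $\mathrm{Round}(F;r,c)$ for a nonnegative matrix $F$ and nonnegative vectors $r,c$ of equal total mass: scale the $i$-th row of $F$ by $\min\{r_i/(F\mathbf 1)_i,1\}$ to get $F'$; scale the $i$-th column of $F'$ by $\min\{c_i/(F'^\top\mathbf 1)_i,1\}$ to get $F''$ (zero rows/columns are left unchanged); return $F''+e_re_c^\top/\|e_r\|_1$ with $e_r=r-F''\mathbf 1$, $e_c=c-F''^\top\mathbf 1$ (return $F''$ if $e_r=0$). Its output is a nonnegative matrix with row sums $r$ and column sums $c$.
   Formalization: Γ is assumed nonempty (else total mass is free and the claim fails), d ≥ 2 and C_∞ > 0; the O-bound on T is proved for δ ≤ κ|E|C_∞ with a constant depending only on the arbitrary κ > 0, since T ≥ 1 while the bound tends to 0 as δ grows. *)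

(* Defs.v *)
From HB Require Import structures.
From mathcomp Require Import all_boot all_order all_algebra.
From mathcomp Require Import all_classical all_reals all_analysis.

Set Implicit Arguments.
Unset Strict Implicit.
Unset Printing Implicit Defensive.

Import Order.TTheory GRing.Theory Num.Theory.

Local Open Scope ring_scope.

(* Real-RAM operation count: a program returns its value together with the    *)
(* number of scalar operations it performed.  The unit-cost operations are    *)
(* + - * / expR, real powers, absolute value, min and comparison; reading     *)
(* inputs, copying, transposing, and the control flow driven by the (given)   *)
(* graph and its bipartition are free.                                        *)

Record counted (A : Type) := Counted { value : A; ops : nat }.

Definition ret (A : Type) (a : A) : counted A := Counted a 0.

Definition bind (A B : Type) (m : counted A) (f : A -> counted B) : counted B :=
  Counted (value (f (value m))) (ops m + ops (f (value m)))%N.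

Notation "'let*' x ':=' m 'in' f" := (bind m (fun x => f))
  (at level 200, x name, m at level 200, f at level 200).

(* [op a]: [a] is a single scalar operation applied to available values. *)
Definition op (A : Type) (a : A) : counted A := Counted a 1.

(* Accumulating with [acc], one operation per accumulated term. *)
Definition bigC (T : Type) (I : finType) (acc : T -> T -> T) (z : T)
    (P : pred I) (F : I -> counted T) : counted T :=
  Counted (\big[acc/z]_(i | P i) value (F i)) (\sum_(i | P i) (ops (F i)).+1)%N.

Definition forC (T : Type) (I : finType) (P : pred I) (old : I -> T)
    (F : I -> counted T) : counted (I -> T) :=
  Counted (fun i => if P i then value (F i) else old i)
          (\sum_(i | P i) ops (F i))%N.

Definition colC (R : Type) (d : nat) (F : 'I_d -> counted R) :
    counted 'cV[R]_d :=
  Counted (\col_a value (F a)) (\sum_a ops (F a))%N.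

Definition mxC (R : Type) (d : nat) (F : 'I_d -> 'I_d -> counted R) :
    counted 'M[R]_d :=
  Counted (\matrix_(a, b) value (F a b)) (\sum_a \sum_b ops (F a b))%N.

(* [repeat_until body stop a r]: executing [repeat body until stop] from the
   state [a] terminates, with final state [value r], after [ops r] operations.
   The test is made only after the first execution of the body. *)
Inductive repeat_until (A : Type) (body : A -> counted A)
    (stop : A -> counted bool) (a : A) : counted A -> Prop :=
| RepeatHalt :
    value (stop (value (body a))) ->
    repeat_until body stop a
      (let* a' := body a in let* b := stop a' in ret a')
| RepeatAgain (r : counted A) :
    ~~ value (stop (value (body a))) ->
    repeat_until body stop (value (body a)) r ->
    repeat_until body stop a
      (let* a' := body a in let* b := stop a' in r).

(* [E] contains exactly one of (j, k), (k, j) for each undirected     *)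
(* edge; quantities are indexed by pairs p = (j, k), in both orientations.    *)

Section Graph.
Variables (V : finType) (E : {set V * V}).

Definition rev_arc (p : V * V) : V * V := (p.2, p.1).

Definition adj : rel V := fun j k => ((j, k) \in E) || ((k, j) \in E).

Definition nbr (j : V) : {set V} := [set k | adj j k].

Definition is_arc : pred (V * V) := fun p => adj p.1 p.2.

Definition is_tree : Prop :=
  [/\ forall j k, (j, k) \in E -> (k, j) \notin E,
      forall j k, connect adj j k
    & forall s : seq V, ucycle adj s -> (size s < 3)%N].

Definition is_bipartition (S1 S2 : {set V}) : Prop :=
  [/\ S1 :|: S2 = [set: V], [disjoint S1 & S2]
    & forall j k, adj j k ->
        ((j \in S1) && (k \in S2)) || ((j \in S2) && (k \in S1))].

Definition nonadjacent_leaves (Gamma : {set V}) : Prop :=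
  (forall j, j \in Gamma -> #|nbr j| = 1%N) /\
  (forall j k, j \in Gamma -> k \in Gamma -> ~~ adj j k).

End Graph.

Section Problem.
Variables (R : realType) (V : finType) (E : {set V * V}) (d : nat).
Variables (Gamma : {set V}) (mu : V -> 'cV[R]_d) (C : V * V -> 'M[R]_d).

Definition is_prob (v : 'cV[R]_d) : Prop :=
  (forall a, 0 <= v a 0) /\ \sum_a v a 0 = 1.

Definition Cinf : R :=
  \big[Num.max/0]_(p in E) \big[Num.max/0]_(a < d) \big[Num.max/0]_(b < d)
    `|C p a b|.

Definition inner (A B : 'M[R]_d) : R := \sum_a \sum_b A a b * B a b.

Definition objective (B : V * V -> 'M[R]_d) : R :=
  \sum_(p in E) inner (C p) (B p).

(* [nu] is the family of all node marginals; only its values outside [Gamma]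
   are free. *)
Definition feasible (B : V * V -> 'M[R]_d) (nu : V -> 'cV[R]_d) : Prop :=
  (forall j, j \in Gamma -> nu j = mu j) /\
  (forall p, p \in E ->
     [/\ forall a b, 0 <= B p a b,
         B p *m const_mx 1 = nu p.1
       & (B p)^T *m const_mx 1 = nu p.2]).

Definition optimal_value : \bar R :=
  ereal_inf [set v : \bar R |
    exists B nu, feasible B nu /\ v = (objective B)%:E]%classic.

Definition approx_solution (delta : R) (B : V * V -> 'M[R]_d) : Prop :=
  (exists nu, feasible B nu) /\
  ((objective B)%:E <= optimal_value + delta%:E)%E.

End Problem.

Section Vectors.
Variables (R : realType) (d : nat).
Implicit Types (v w r c : 'cV[R]_d) (F : 'M[R]_d).

Definition rowsum F : counted 'cV[R]_d :=
  colC (fun a => bigC +%R 0 predT (fun b => ret (F a b))).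

Definition colsum F : counted 'cV[R]_d := rowsum F^T.

Definition vsub v w : counted 'cV[R]_d := colC (fun a => op (v a 0 - w a 0)).

Definition norm1 v : counted R := bigC +%R 0 predT (fun a => op `|v a 0|).

Definition dist1 v w : counted R := let* x := vsub v w in norm1 x.

Definition normalize v : counted 'cV[R]_d :=
  let* s := norm1 v in colC (fun a => op (v a 0 / s)).

Definition round_factor (target s : R) : counted R :=
  let* z := op (s == 0) in
  if z then ret 1 else
  let* x := op (target / s) in op (Num.min x 1).

Definition Round F r c : counted 'M[R]_d :=
  let* f := rowsum F in
  let* x := colC (fun a => round_factor (r a 0) (f a 0)) in
  let* F' := mxC (fun a b => op (F a b * x a 0)) in
  let* g := colsum F' in
  let* y := colC (fun b => round_factor (c b 0) (g b 0)) in
  let* F'' := mxC (fun a b => op (F' a b * y b 0)) in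
  let* f'' := rowsum F'' in
  let* er := vsub r f'' in
  let* g'' := colsum F'' in
  let* ec := vsub c g'' in
  let* n := norm1 er in
  let* z := op (n == 0) in
  if z then ret F'' else
  mxC (fun a b =>
    let* s := op (er a 0 * ec b 0) in
    let* t := op (s / n) in
    op (F'' a b + t)).

End Vectors.

(* A node j of [Gamma] has the single neighbour k_j, so  *)
(* "k ranging over N(j)" means k = k_j there.                                 *)

Section Algorithms.
Variables (R : realType) (V : finType) (E : {set V * V}) (d : nat).
Variables (Gamma : {set V}) (mu : V -> 'cV[R]_d) (C : V * V -> 'M[R]_d).
Variables (S1 S2 : {set V}).

Local Notation vecs := (V * V -> 'cV[R]_d).
Local Notation mats := (V * V -> 'M[R]_d).

(* The part updated in the iteration t -> t + 1. *)
Definition side (t : nat) : {set V} := if odd t then S2 else S1.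

(* The arcs (j, k) with j in S. *)
Definition arc_from (S : {set V}) : pred (V * V) :=
  fun p => is_arc E p && (p.1 \in S).

Definition gamma_of (j : V) : 'cV[R]_d :=
  if j \in Gamma then mu j else const_mx 1.

Definition average (q : vecs) (j : V) : counted 'cV[R]_d :=
  colC (fun a =>
    let* s := bigC +%R 0 (mem (nbr E j)) (fun k => ret (q (j, k) a 0)) in
    op (s / #|nbr E j|%:R)).

Definition geomean (q : vecs) (j : V) : counted 'cV[R]_d :=
  colC (fun a =>
    let* s := bigC *%R 1 (mem (nbr E j)) (fun k => ret (q (j, k) a 0)) in
    let* x := op (#|nbr E j|%:R^-1) in
    op (s `^ x)).

Definition gibbs_kernel (eps : R) : counted mats :=
  forC (is_arc E) (fun=> 0) (fun p =>
    mxC (fun a b =>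
      let* x := op (C p a b / eps) in
      let* y := op (- x) in
      op (expR y))).

(* B^t_p, computed from u^t. *)
Definition scaled (K : mats) (u : vecs) (p : V * V) : counted 'M[R]_d :=
  let* x := colC (fun a => op (u p a 0 * gamma_of p.1 a 0)) in
  let* y := colC (fun b => op (u (rev_arc p) b 0 * gamma_of p.2 b 0)) in
  mxC (fun a b => let* z := op (x a 0 * K p a b) in op (z * y b 0)).

(* q^t_p *)
Definition marginal (K : mats) (u : vecs) (p : V * V) : counted 'cV[R]_d :=
  let* B := scaled K u p in rowsum B.

(* Coordinates where mu_j vanishes get the entry of 1 ./ (K u_(k_j, j)). *)
Definition update_leaf (K : mats) (u q : vecs) (p : V * V) :
    counted 'cV[R]_d :=
  colC (fun a =>
    let* z := op (mu p.1 a 0 == 0) in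
    if z then
      let* s := bigC +%R 0 predT (fun b => op (K p a b * u (rev_arc p) b 0)) in
      op (1 / s)
    else
      let* x := op (u p a 0 * mu p.1 a 0) in
      op (x / q p a 0)).

Definition update_inner (u q : vecs) (m : V -> 'cV[R]_d) (p : V * V) :
    counted 'cV[R]_d :=
  colC (fun a =>
    let* x := op (u p a 0 * m p.1 a 0) in
    op (x / q p a 0)).

Definition bis_step (K : mats) (S : {set V}) (u : vecs) : counted vecs :=
  let* q := forC (arc_from S) (fun=> 0) (marginal K u) in
  let* m := forC (mem (S :\: Gamma)) (fun=> 0) (fun j =>
              let* g := geomean q j in normalize g) in
  forC (arc_from S) u (fun p =>
    if p.1 \in Gamma then update_leaf K u q p else update_inner u q m p).

Definition mismatch (K : mats) (u : vecs) : counted R :=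
  let* q := forC (is_arc E) (fun=> 0) (marginal K u) in
  let* m := forC (mem (~: Gamma)) (fun=> 0) (average q) in
  let* x := bigC +%R 0 (mem Gamma) (fun j =>
              bigC +%R 0 (mem (nbr E j)) (fun k => dist1 (q (j, k)) (mu j))) in
  let* y := bigC +%R 0 (mem (~: Gamma)) (fun j =>
              bigC +%R 0 (mem (nbr E j)) (fun k => dist1 (q (j, k)) (m j))) in
  op (x + y).

(* The state of the loop is (t, u^t). *)
Definition iteration (K : mats) (s : nat * vecs) : counted (nat * vecs) :=
  let* u := bis_step K (side s.1) s.2 in ret (s.1.+1, u).

Definition stop_test (K : mats) (delta' : R) (s : nat * vecs) : counted bool :=
  let* x := mismatch K s.2 in op (x <= delta').

(* Bipartite Iterative Scaling terminates, returning the number of iterations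
   and the matrices B^t. *)
Definition bipartite_iterative_scaling (eps delta' : R)
    (out : counted (nat * mats)) : Prop :=
  let K := gibbs_kernel eps in
  exists2 s : counted (nat * vecs),
    repeat_until (iteration (value K)) (stop_test (value K) delta')
      (0%N, fun=> const_mx 1) s
  & out = let* K0 := K in
          let* tu := s in
          let* B := forC (is_arc E) (fun=> 0) (scaled K0 tu.2) in
          ret (tu.1, B).

Definition rounding (S : {set V}) (B : mats) : counted mats :=
  let* q := forC (arc_from S) (fun=> 0) (fun p => rowsum (B p)) in
  let* m := forC (mem (S :\: Gamma)) (fun=> 0) (average q) in
  let* Bh := forC (arc_from S) (fun=> 0) (fun p =>
    let* c := colsum (B p) in
    Round (B p) (if p.1 \in Gamma then mu p.1 else m p.1) c) in
  ret (fun p => if p.1 \in S then Bh p else (Bh (rev_arc p))^T).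

(* After t iterations the part not updated last is [side t]. *)
Definition scaling_then_rounding (eps delta' : R) (res : counted mats) : Prop :=
  exists2 out : counted (nat * mats),
    bipartite_iterative_scaling eps delta' out
  & res = let* tB := out in rounding (side tB.1) tB.2.

End Algorithms.

(* Main.v *)
Require Import Defs.
From HB Require Import structures.
From mathcomp Require Import all_boot all_order all_algebra.
From mathcomp Require Import all_classical all_reals all_analysis.
From mathcomp Require Import ring lra zify.

Set Implicit Arguments.
Unset Strict Implicit.
Unset Printing Implicit Defensive.

Import Order.TTheory GRing.Theory Num.Theory.

Local Open Scope ring_scope.

(* The matrices produced by the scaling are B = diag(u g) K diag(u g), where
   off Gamma the logarithms of the u_(j,k), k in N(j), sum to a constant
   vector, and where every ln u_(j,k) stays within 2 Cinf / eps of a constant.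
   Hence, writing D for the dual objective sum <ln u, marginal> and m for the
   total marginal mismatch,
   - concavity gives D(u^T) - D(u^t) <= (4 Cinf / eps) m_t, without using a dual
     optimizer;
   - an iteration increases D by a sum of relative entropies, hence by at least
     m_t^2 / (16 |E|).
   These bounds leave m_t > delta' for at most 256 |E| Cinf / (eps delta')
   iterations.  For a feasible B*, expanding C = eps (ln u + ln u' - ln M), with
   M = diag(u) K diag(u'), on each edge bounds the cost of B minus that of B* by
   2 eps |E| ln d + 2 Cinf m, and rounding costs at most Cinf m more. *)

(** * Inequalities *)

(** The weights [gamma] stay separate from the potentials. The update of a leaf divides by a
    positive vector even where [mu_j] vanishes, so every logarithm is finite and the oscillation
    bounds hold at all coordinates; zeros of the marginals enter only through the weights, which are
    at most 1 and whose products over an edge dominate the entries of every feasible plan.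

    Constants added to a potential are harmless because differences of marginals of equal mass sum
    to zero. This is why balance and boundedness are required only modulo constants, and why
    normalizing the geometric mean does no damage.

    Dividing the initial dual gap by the least gain [delta'^2 / (16 |E|)] of an iteration would give
    a count of order [1 / (eps delta'^2)]. Bounding the current gap by the current mismatch saves
    one factor [1 / delta'], since a large gap forces a large gain. Both [eps] and [delta'] are
    linear in [delta], whence the exponent 2.

    Relative entropies are compared with L1 distances through one parameter [lam] shared by all arcs
    and chosen only after summation. *)

Section RealInequalities.
Variables (R : realType) (I : finType).
Implicit Types (x v tau q D W M P : I -> R).

Lemma ln_le_sub1 (x : R) : 0 < x -> ln x <= x - 1.
Proof.
by move=> x0; have := @le_ln1Dx R (x - 1); rewrite subrKC; apply; lra.
Qed.

(* Relative entropy dominates the squared Hellinger distance, since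
   [ln (t / q) >= 2 (1 - sqrt (q / t))]; Young's inequality then replaces
   Cauchy-Schwarz. *)
Lemma kl_lower_bound tau q D (lam : R) : 0 < lam ->
  (forall a, 0 <= tau a) -> (forall a, 0 <= q a) ->
  (forall a, 0 < tau a -> 0 < q a /\ D a = ln (tau a) - ln (q a)) ->
  \sum_a tau a = 1 -> \sum_a q a = 1 ->
  \sum_a `|tau a - q a| <= lam / 2 * (\sum_a tau a * D a) + 2 / lam.
Proof.
move=> lam0 tau0 q0 hD tau1 q1.
have pt a : `|tau a - q a| <=
    lam / 2 * (tau a * D a - tau a + q a) + (tau a + q a) / lam.
  set s := Num.sqrt (tau a); set r := Num.sqrt (q a).
  have s0 : 0 <= s by exact: sqrtr_ge0.
  have r0 : 0 <= r by exact: sqrtr_ge0.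
  have es : tau a = s ^+ 2 by rewrite sqr_sqrtr.
  have er : q a = r ^+ 2 by rewrite sqr_sqrtr.
  have kl : (s - r) ^+ 2 <= tau a * D a - tau a + q a.
    have [t0|] := ltP 0 (tau a); last first.
      move=> t0; have t00 : tau a = 0 by apply/le_anti; rewrite t0 tau0.
      have -> : s = 0 by rewrite /s t00 sqrtr0.
      by rewrite t00 er; lra.
    have [qp ->] := hD a t0.
    have sp : 0 < s by rewrite sqrtr_gt0.
    have rp : 0 < r by rewrite sqrtr_gt0.
    have h := ln_le_sub1 (divr_gt0 rp sp).
    rewrite ln_div ?posrE // in h.
    rewrite es er !lnXn //.
    have h2 : s ^+ 2 * (ln r - ln s) <= s ^+ 2 * (r / s - 1).
      by rewrite ler_pM2l // exprn_gt0.
    have e : s ^+ 2 * (r / s - 1) = s * r - s ^+ 2 by field; lra.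
    rewrite e in h2; nra.
  have -> : `|tau a - q a| = `|s - r| * (s + r).
    by rewrite es er subr_sqr normrM (ger0_norm (addr_ge0 s0 r0)).
  apply: (@le_trans _ _ (lam / 2 * (s - r) ^+ 2 + (s ^+ 2 + r ^+ 2) / lam)).
    rewrite -(real_normK (num_real (s - r))).
    set z := `|s - r|; have z0 : 0 <= z := normr_ge0 _.
    rewrite -subr_ge0.
    have -> : lam / 2 * z ^+ 2 + (s ^+ 2 + r ^+ 2) / lam - z * (s + r) =
      ((lam * z - (s + r)) ^+ 2 + (s - r) ^+ 2) / (2 * lam) by field; lra.
    by rewrite divr_ge0 ?addr_ge0 ?sqr_ge0 //; lra.
  by rewrite -es -er lerD2r ler_pM2l //; lra.
apply: (le_trans (ler_sum _ (fun a _ => pt a))).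
rewrite big_split /= -mulr_sumr -mulr_suml !big_split /= sumrN tau1 q1.
by rewrite addrNK.
Qed.

(** In the application [W M] is a scaled matrix with its weights [W] split off, and [P] is a
    competitor. The tangent bound on [ln (M i)] gives [P ln M <= P (M - 1) <= W M - P], which sums
    to zero; the same bound at [1 / (n M i)], with [n = #|I|], gives
    [- W M ln M <= 1 / n - W M + W M ln n], which sums to [ln n]. *)
Lemma entropy_gap W M P : (0 < #|I|)%N ->
  (forall i, W i <= 1) -> (forall i, 0 < M i) -> \sum_i W i * M i = 1 ->
  (forall i, 0 <= P i <= W i) -> \sum_i P i = 1 ->
  \sum_i (P i - W i * M i) * ln (M i) <= ln #|I|%:R.
Proof.
move=> n0 W1 M0 WM1 hP P1; set n : R := #|I|%:R.
have np : 0 < n by rewrite ltr0n.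
have pt i : (P i - W i * M i) * ln (M i) <=
    (W i * M i - P i) + (n^-1 - W i * M i) + W i * M i * ln n.
  have /andP[P0 PW] := hP i; have Mi := M0 i.
  have W0 := le_trans P0 PW.
  have h1 := ln_le_sub1 Mi.
  have nM : 0 < n * M i by rewrite mulr_gt0.
  have h2 : ln ((n * M i)^-1) <= (n * M i)^-1 - 1 by apply: ln_le_sub1;
    rewrite invr_gt0.
  rewrite lnV ?posrE // lnM ?posrE // in h2.
  have h3 : P i * ln (M i) <= W i * M i - P i.
    apply: (le_trans (ler_wpM2l P0 h1)); rewrite mulrBr mulr1 lerD2r.
    by rewrite ler_wpM2r // ltW.
  have h4 : W i * M i * (- (ln n + ln (M i))) <= n^-1 - W i * M i.
    have WM0 : 0 <= W i * M i by rewrite mulr_ge0 // ltW.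
    apply: (le_trans (ler_wpM2l WM0 h2)); rewrite mulrBr mulr1 lerD2r.
    have -> : W i * M i * (n * M i)^-1 = W i * n^-1 by field; lra.
    by rewrite ler_piMl ?invr_ge0 // ltW.
  lra.
apply: (le_trans (ler_sum _ (fun i _ => pt i))).
rewrite !big_split /= !sumrN -mulr_suml WM1 P1 sumr_const -[in X in X <=
  _]mulr_natl -/n.
by rewrite mulfV ?lt0r_neq0 //; lra.
Qed.

(* Half of the oscillation of [x] is at most [r]. *)
Definition within x (r : R) := exists c, forall a, `|x a - c| <= r.

(** As [v] has zero sum, [x] may be recentred before absolute values are taken. *)
Lemma within_pairing x v r : within x r -> \sum_a v a = 0 ->
  \sum_a x a * v a <= r * \sum_a `|v a|.
Proof.
move=> [c hc] v0.
have -> : \sum_a x a * v a = \sum_a (x a - c) * v a.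
  under [RHS]eq_bigr do rewrite mulrBl.
  by rewrite big_split /= sumrN -mulr_sumr v0 mulr0 subr0.
rewrite mulr_sumr; apply: ler_sum => a _.
by apply: (le_trans (ler_norm _)); rewrite normrM ler_wpM2r.
Qed.

Lemma eq_within x y r : x =1 y -> within x r -> within y r.
Proof. by move=> xy [c hc]; exists c => a; rewrite -xy. Qed.

Lemma within_le x r r' : r <= r' -> within x r -> within x r'.
Proof. by move=> rr [c hc]; exists c => a; exact: le_trans rr. Qed.

Lemma within_cst (k : R) : within (fun=> k) 0.
Proof. by exists k => a; rewrite subrr normr0. Qed.

Lemma withinN x r : within x r -> within (fun a => - x a) r.
Proof. by move=> [c hc]; exists (- c) => a; rewrite -opprD normrN. Qed.

Lemma withinD x y r s : within x r -> within y s ->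
  within (fun a => x a + y a) (r + s).
Proof.
move=> [c hc] [e he]; exists (c + e) => a.
rewrite (_ : _ - _ = (x a - c) + (y a - e)); last by ring.
by rewrite (le_trans (ler_normD _ _)) // lerD.
Qed.

Lemma within_mean (J : finType) (A : pred J) (x : J -> I -> R) r :
  (0 < #|A|)%N -> (forall k, A k -> within (x k) r) ->
  within (fun a => #|A|%:R^-1 * \sum_(k | A k) x k a) r.
Proof.
move=> n0 hx.
have /fin_all_exists[c hc] : forall k, exists c, A k -> forall a, `|x k a - c|
  <= r.
  move=> k; have [Ak|] := boolP (A k); last by exists 0.
  by have [c hc] := hx k Ak; exists c.
exists (#|A|%:R^-1 * \sum_(k | A k) c k) => a.
have np : 0 < #|A|%:R :> R by rewrite ltr0n.
rewrite -mulrBr -sumrB normrM ger0_norm ?invr_ge0 ?ler0n // ler_pdivrMl //.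
apply: (le_trans (ler_norm_sum _ _ _)).
rewrite mulr_natl -sumr_const; apply: ler_sum => k Ak; exact: hc.
Qed.

(** Two-sided bounds on the kernel confine [K w] between multiples of the total mass of [w],
    whatever [w] is. This is what bounds the potentials uniformly in the iteration count. *)
Lemma within_ln_kernel (J : finType) (K : I -> J -> R) (w : J -> R) (r : R) :
  (forall a b, expR (- r) <= K a b <= expR r) ->
  (forall b, 0 <= w b) -> 0 < \sum_b w b ->
  within (fun a => ln (\sum_b K a b * w b)) r.
Proof.
move=> hK w0 ws; exists (ln (\sum_b w b)) => a.
have lo : expR (- r) * (\sum_b w b) <= \sum_b K a b * w b.
  rewrite mulr_sumr; apply: ler_sum => b _; apply: ler_wpM2r => //.
  by case/andP: (hK a b).
have hi : \sum_b K a b * w b <= expR r * (\sum_b w b).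
  rewrite mulr_sumr; apply: ler_sum => b _; apply: ler_wpM2r => //.
  by case/andP: (hK a b).
have lo0 : 0 < expR (- r) * (\sum_b w b) by rewrite mulr_gt0 ?expR_gt0.
have s0 := lt_le_trans lo0 lo; have hi0 := lt_le_trans s0 hi.
rewrite -ler_ln ?posrE // lnM ?posrE ?expR_gt0 // expRK in lo.
rewrite -ler_ln ?posrE // lnM ?posrE ?expR_gt0 // expRK in hi.
by rewrite ler_distl; apply/andP; split; lra.
Qed.

End RealInequalities.

Lemma ln_prod (R : realType) (J : finType) (A : pred J) (x : J -> R) :
  (forall k, A k -> 0 < x k) ->
  ln (\prod_(k | A k) x k) = \sum_(k | A k) ln (x k).
Proof.
move=> x0.
suff [] : 0 < \prod_(k | A k) x k /\
    ln (\prod_(k | A k) x k) = \sum_(k | A k) ln (x k) by [].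
apply: (big_ind2 (fun p s => 0 < p /\ ln p = s)) =>
  [|p s p' s' [p0 <-] [p0' <-]|k Ak].
- by rewrite ln1.
- by rewrite mulr_gt0 // lnM ?posrE.
- by rewrite x0.
Qed.

(** For [m > 0] the choice [lam = 2 c / m] yields the claim. The case [m = 0] needs [0 <= D], which
    is also extracted from the hypothesis: a large [lam] would contradict [0 <= m] if [D] were
    negative. *)
Lemma sqr_le_of_young (R : realType) (m D c : R) : 0 < c -> 0 <= m ->
  (forall lam, 0 < lam -> m <= lam * D + c / lam) -> m ^+ 2 <= 4 * c * D.
Proof.
move=> c0 m0 H.
have D0 : 0 <= D.
  rewrite leNgt; apply/negP => D0.
  have q0 : 0 < (c + 1) / - D by rewrite divr_gt0 ?oppr_gt0 ?addr_gt0.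
  set lam := Num.sqrt ((c + 1) / - D).
  have l0 : 0 < lam by rewrite sqrtr_gt0.
  have l2 : lam ^+ 2 * D = - (c + 1).
    by rewrite sqr_sqrtr ?(ltW q0) //; field; rewrite lt_eqF.
  have := ler_wpM2l (ltW l0) (le_trans m0 (H _ l0)).
  have -> : lam * (lam * D + c / lam) = lam ^+ 2 * D + c.
    by field; rewrite lt0r_neq0.
  by rewrite mulr0 l2; lra.
have [mz|mp] := leP m 0.
  have -> : m = 0 by apply/le_anti; rewrite mz m0.
  by rewrite expr0n /= !mulr_ge0 // ltW.
have h : m <= 2 * c / m * D + c / (2 * c / m) by apply: H;
  rewrite divr_gt0 ?mulr_gt0.
have := ler_wpM2l (ltW mp) h.
have -> : m * (2 * c / m * D + c / (2 * c / m)) = 2 * c * D + m ^+ 2 / 2.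
  by field; rewrite !lt0r_neq0.
by rewrite -expr2; lra.
Qed.

(* With [h t = Psi N - Psi t + r del], one has [h t <= 2 r m t], so the
   increase hypothesis gives [h t.+1 <= h t - h t ^ 2 / (4 r^2 A)], whence
   [t h t <= 4 r^2 A]. *)
Lemma descent_bound (R : realFieldType) (Psi m : nat -> R) (r A del : R) N :
  0 < r -> 0 < A -> 0 < del ->
  (forall t, (t < N)%N ->
    [/\ del <= m t, m t ^+ 2 <= A * (Psi t.+1 - Psi t)
      & Psi N - Psi t <= r * m t]) ->
  N%:R <= 4 * r * A / del.
Proof.
move=> r0 A0 del0 H.
pose h t := Psi N - Psi t + r * del.
pose B := 4 * r ^+ 2 * A.
have B0 : 0 < B by rewrite !mulr_gt0 // exprn_gt0.
have PsiN t : (t <= N)%N -> Psi t <= Psi N.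
  move=> tN; rewrite -(subnK tN) addnC.
  have: (t + (N - t) <= N)%N by rewrite subnKC.
  elim: (N - t)%N => [|k IH] kN; first by rewrite addn0.
  rewrite addnS in kN *; apply: (le_trans (IH (ltnW kN))).
  have [_ hm _] := H _ kN.
  by rewrite -subr_ge0 -(pmulr_rge0 _ A0); apply: le_trans hm; exact: sqr_ge0.
have hpos t : (t <= N)%N -> 0 < h t.
  by move=> tN; have := PsiN t tN; rewrite /h; have := mulr_gt0 r0 del0; lra.
have key t : (t <= N)%N -> t%:R * h t <= B.
  elim: t => [|t IH] tN; first by rewrite mul0r ltW.
  have ht := hpos t (ltnW tN); have {}IH := IH (ltnW tN).
  have [dm hm rm] := H t tN.
  have h2 : h t <= 2 * r * m t.
    rewrite /h; have := ler_wpM2l (ltW r0) dm; lra.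
  have st : h t ^+ 2 <= B * (h t - h t.+1).
    apply: (@le_trans _ _ ((2 * r * m t) ^+ 2)).
      by rewrite ler_sqr ?nnegrE // ?(le_trans _ h2) // ltW.
    rewrite (_ : B * _ = (2 * r) ^+ 2 * (A * (Psi t.+1 - Psi t)));
      last by rewrite /B /h; ring.
    by rewrite exprMn ler_wpM2l // sqr_ge0.
  rewrite -(ler_pM2l B0) mulrCA.
  have t1 : 0 <= t.+1%:R :> R by exact: ler0n.
  apply: (@le_trans _ _ (t.+1%:R * (B * h t - h t ^+ 2))).
    by rewrite ler_wpM2l //; lra.
  (* At [t = 0] the induction hypothesis puts no bound on [h t], so a value above [B] is treated
     apart; there [B * h t - h t ^+ 2] is negative. *)
  have [xB|xB] := leP (h t) B; last first.
    apply: (@le_trans _ _ 0); last by rewrite mulr_ge0 // ltW.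
    by rewrite mulr_ge0_le0 //; nra.
  rewrite -natr1 (_ : _ * _ = (t%:R * h t + h t) * (B - h t)); last by ring.
  apply: (@le_trans _ _ ((B + h t) * (B - h t))); last by nra.
  by apply: ler_wpM2r; lra.
(* Since [h N = r * del], the shift in [h] turns the bound on [N * h N] into one of order
   [1 / del]. *)
have := key N (leqnn _).
rewrite /h subrr add0r ler_pdivlMr // => hN.
rewrite -(ler_pM2l r0) mulrCA (le_trans hN) // /B.
by rewrite (_ : _ * A = r * (4 * r * A)) //; ring.
Qed.

(** * Rounding to prescribed marginals *)

Section Rounding.
Variables (R : realType) (d : nat).
Implicit Types (F : 'M[R]_d) (r c v w : 'cV[R]_d).

Lemma rowsumE F a : value (rowsum F) a 0 = \sum_b F a b.
Proof. by rewrite mxE. Qed.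

Lemma colsumE F b : value (colsum F) b 0 = \sum_a F a b.
Proof. by rewrite rowsumE; apply: eq_bigr => a _; rewrite mxE. Qed.

Lemma dist1E v w : value (dist1 v w) = \sum_a `|v a 0 - w a 0|.
Proof. by apply: eq_bigr => a _; rewrite mxE. Qed.

Lemma normalizeE v a :
  value (normalize v) a 0 = v a 0 / \sum_b `|v b 0|.
Proof. by rewrite mxE. Qed.

Lemma round_factorE (t s : R) :
  value (round_factor t s) = if s == 0 then 1 else Num.min (t / s) 1.
Proof. by rewrite /round_factor /=; case: ifP. Qed.

Lemma round_factorM (t s : R) : 0 <= t -> 0 <= s ->
  s * value (round_factor t s) = Num.min t s.
Proof.
move=> t0 s0; rewrite round_factorE; case: eqVneq => [->|sn0].
  by rewrite mul0r min_r.
by rewrite minr_pMr // mulr1 mulrC divfK.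
Qed.

Lemma round_factor_itv (t s : R) : 0 <= t -> 0 <= s ->
  0 <= value (round_factor t s) <= 1.
Proof.
move=> t0 s0; rewrite round_factorE; case: ifP => _;
  first by rewrite ler01 lexx.
by rewrite le_min divr_ge0 //= ler01 ge_min lexx orbT.
Qed.

(** The prescribed column sums are those of [F] itself. A row then loses its excess over [r] by
    scaling and regains its deficit through the rank-one correction, and at most one of the two is
    nonzero; hence the constant 1 in the last bound. *)
Lemma RoundP F r : (forall a b, 0 <= F a b) -> (forall a, 0 <= r a 0) ->
  \sum_a r a 0 = \sum_a \sum_b F a b ->
  let G := value (Round F r (value (colsum F))) in
  [/\ forall a b, 0 <= G a b,
      forall a, \sum_b G a b = r a 0,
      forall b, \sum_a G a b = \sum_a F a b
    & \sum_a \sum_b `|G a b - F a b| <= \sum_a `|\sum_b F a b - r a 0|].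
Proof.
move=> F0 r0 rF.
pose f a := \sum_b F a b.
have f0 a : 0 <= f a by apply: sumr_ge0.
pose x a := value (round_factor (r a 0) (f a)).
have x01 a : 0 <= x a <= 1 by apply: round_factor_itv.
have fx a : f a * x a = Num.min (r a 0) (f a) by apply: round_factorM.
pose F' : 'M[R]_d := \matrix_(a, b) (F a b * x a).
have F'0 a b : 0 <= F' a b by rewrite mxE mulr_ge0 //; case/andP: (x01 a).
have F'F a b : F' a b <= F a b.
  by rewrite mxE ler_piMr //; case/andP: (x01 a).
have rowF' a : \sum_b F' a b = Num.min (r a 0) (f a).
  by rewrite -fx mulr_suml; apply: eq_bigr => b _; rewrite mxE.
(* The column step is void: row scaling only decreased the column sums. *)
pose F2 : 'M[R]_d := \matrix_(a, b) (F' a b *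
  value (round_factor (value (colsum F) b 0) (value (colsum F') b 0))).
have F2E : F2 = F'.
  apply/matrixP => a b; rewrite mxE round_factorE !colsumE.
  case: eqVneq => [_|s0]; first by rewrite mulr1.
  rewrite min_r ?mulr1 // ler_pdivlMr ?mul1r; first by apply: ler_sum.
  by rewrite lt_def s0 sumr_ge0.
pose er : 'cV[R]_d := \col_a (r a 0 - \sum_b F' a b).
pose ec : 'cV[R]_d := \col_b (\sum_a F a b - \sum_a F' a b).
have er0 a : 0 <= er a 0.
  by rewrite mxE rowF' subr_ge0 ge_min lexx.
have ec0 b : 0 <= ec b 0 by rewrite mxE subr_ge0; apply: ler_sum.
pose n := \sum_a er a 0.
have nec : \sum_b ec b 0 = n.
  rewrite /n; under eq_bigr do rewrite mxE; under [RHS]eq_bigr do rewrite mxE.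
  rewrite !sumrB rF; congr (_ - _); exact: exchange_big.
have GE : value (Round F r (value (colsum F))) =
    \matrix_(a, b) (F' a b + er a 0 * ec b 0 / n).
  (* Naming the intermediate matrices lets conversion split the program before its final branch;
     [rest] is the part after both scalings. *)
  pose c := value (colsum F).
  pose Fx := value (mxC (fun a b => op (F a b *
    value (colC (fun a => round_factor (r a 0) (value (rowsum F) a 0))) a 0))).
  pose Fxy := value (mxC (fun a b => op (Fx a b *
    value (colC (fun b => round_factor (c b 0) (value (colsum Fx) b 0))) b 0))).
  pose rest X :=
    let* f'' := rowsum X in
    let* er := vsub r f'' in
    let* g'' := colsum X in
    let* ec := vsub c g'' in
    let* n := norm1 er in
    let* z := op (n == 0) in
    if z then ret X else
    mxC (fun a b =>
      let* s := op (er a 0 * ec b 0) in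
      let* t := op (s / n) in
      op (X a b + t)).
  rewrite -[LHS]/(value (rest Fxy)).
  have FxE : Fx = F' by apply/matrixP => a b; rewrite !mxE.
  have -> : Fxy = F' by rewrite -F2E; apply/matrixP => a b;
    rewrite /Fxy FxE !mxE.
  have erE : value (vsub r (value (rowsum F'))) = er.
    by apply/colP => a; rewrite !mxE.
  have ecE : value (vsub c (value (colsum F'))) = ec.
    by apply/colP => b; rewrite [LHS]mxE [RHS]mxE /c !colsumE.
  have nE : value (norm1 er) = n.
    by apply: eq_bigr => a _; rewrite ger0_norm.
  rewrite -[LHS]/(value (if value (norm1 (value (vsub r (value (rowsum F')))))
    == 0
    then ret F' else mxC (fun a b =>
      let* s := op (value (vsub r (value (rowsum F'))) a 0 *
        value (vsub c (value (colsum F'))) b 0) in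
      let* t := op (s / value (norm1 (value (vsub r (value (rowsum F')))))) in
      op (F' a b + t)))).
  (* When [n = 0] the program returns [F'], and the formula agrees because division by zero yields
     zero. *)
  rewrite erE ecE nE; case: eqVneq => [->|_] //=.
  by apply/matrixP => a b; rewrite [RHS]mxE invr0 mulr0 addr0.
have n0 : 0 <= n by apply: sumr_ge0.
have rowE a : \sum_b er a 0 * ec b 0 / n = er a 0.
  rewrite -mulr_suml -mulr_sumr nec; have [nz|/mulfK->//] := eqVneq n 0.
  by rewrite nz invr0 mulr0; move/psumr_eq0P: (nz) => ->.
have colE b : \sum_a er a 0 * ec b 0 / n = ec b 0.
  rewrite -!mulr_suml -/n mulrC; have [nz|/mulKf->//] := eqVneq n 0.
  by rewrite nz invr0 mul0r; move: nec; rewrite nz => /psumr_eq0P ->.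
rewrite GE; split => [a b|a|b|].
- by rewrite mxE addr_ge0 // divr_ge0 // mulr_ge0.
- under eq_bigr do rewrite mxE.
  by rewrite big_split /= rowE mxE addrC subrK.
- under eq_bigr do rewrite mxE.
  by rewrite big_split /= colE mxE addrC subrK.
apply: ler_sum => a _.
apply: (@le_trans _ _ (\sum_b (F a b - F' a b) + er a 0)).
  rewrite -[X in _ <= _ + X]rowE -big_split /=; apply: ler_sum => b _.
  rewrite mxE addrAC (le_trans (ler_normD _ _)) //.
  rewrite ler0_norm ?opprB ?subr_le0 // lerD2l ger0_norm //.
  by rewrite divr_ge0 // mulr_ge0.
rewrite sumrB mxE rowF' -/(f a).
have [rf|rf] := leP (r a 0) (f a).
  by rewrite ger0_norm ?subr_ge0 //; lra.
by rewrite ltr0_norm ?subr_lt0 //; lra.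
Qed.

End Rounding.

(** * Scaling iterations and the dual objective *)

Section ArcSums.
Variables (R : realType) (V : finType) (E : {set V * V}).
Implicit Types (p : V * V) (f : V * V -> R).

Lemma rev_arcK p : rev_arc (rev_arc p) = p.
Proof. by case: p. Qed.

Lemma rev_is_arc p : is_arc E (rev_arc p) = is_arc E p.
Proof. by rewrite /is_arc /adj /= orbC. Qed.

Lemma mem_nbr_arc j k : (k \in nbr E j) = is_arc E (j, k).
Proof. by rewrite inE. Qed.

Lemma edge_is_arc p : p \in E -> is_arc E p.
Proof. by case: p => j k; rewrite /is_arc /adj /= => ->. Qed.

Lemma sum_arcs_nbr (T : nmodType) (f : V * V -> T) (P : pred V) :
  \sum_(p | is_arc E p && P p.1) f p =
  \sum_(j | P j) \sum_(k in nbr E j) f (j, k).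
Proof.
rewrite pair_big_dep /=; apply: eq_big => [[j k]|[j k] _ //] /=.
by rewrite inE andbC.
Qed.

Lemma sum_arcs_edges (T : nmodType) (f : V * V -> T) :
  (forall j k, (j, k) \in E -> (k, j) \notin E) ->
  \sum_(p | is_arc E p) f p = \sum_(p in E) (f p + f (rev_arc p)).
Proof.
move=> asym; rewrite big_split /= (bigID (mem E)) /=; congr (_ + _).
  by apply: eq_bigl => -[j k]; rewrite /is_arc /adj /=; case: (_ \in E);
    rewrite ?andbF ?orbF.
rewrite [RHS](reindex_inj (can_inj rev_arcK)) /=.
apply: eq_big => [[j k]|p _]; last by rewrite rev_arcK.
rewrite /is_arc /adj /=; case: (boolP ((j, k) \in E)) => [/asym/negPf->|_] //=.
by rewrite andbT.
Qed.

End ArcSums.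

Section Dynamics.
Variables (R : realType) (V : finType) (E : {set V * V}) (d : nat).
Variables (Gamma : {set V}) (mu : V -> 'cV[R]_d).
Variables (K : V * V -> 'M[R]_d) (kap : R).

Local Notation vecs := (V * V -> 'cV[R]_d).
Implicit Types (u v : vecs) (p : V * V) (S : {set V}).

Hypothesis d_gt0 : (0 < d)%N.
Hypothesis E_asym : forall j k, (j, k) \in E -> (k, j) \notin E.
Hypothesis mu_prob : forall j, j \in Gamma -> is_prob (mu j).
Hypothesis Gamma_nonadj :
  forall j k, j \in Gamma -> k \in Gamma -> ~~ adj E j k.
Hypothesis K_rev : forall p, is_arc E p -> K (rev_arc p) = (K p)^T.
Hypothesis kap_ge0 : 0 <= kap.
Hypothesis K_bounds : forall p, is_arc E p ->
  forall a b, expR (- kap) <= K p a b <= expR kap.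

Local Notation gam := (gamma_of Gamma mu).

(** The factor of the row marginal that does not involve [u p]. An update divides by it, and it
    stays positive at coordinates where the weight of [p.1] vanishes. *)
Definition response u p (a : 'I_d) : R :=
  \sum_b K p a b * (u (rev_arc p) b 0 * gam p.2 b 0).

Definition row_marginal u p (a : 'I_d) : R :=
  value (marginal Gamma mu K u p) a 0.

Lemma scaledE u p a b : value (scaled Gamma mu K u p) a b =
  u p a 0 * gam p.1 a 0 * K p a b * (u (rev_arc p) b 0 * gam p.2 b 0).
Proof. by rewrite /scaled /= !mxE. Qed.

Lemma row_marginalE u p a :
  row_marginal u p a = u p a 0 * gam p.1 a 0 * response u p a.
Proof.
rewrite /row_marginal rowsumE mulr_sumr; apply: eq_bigr => b _.
by rewrite scaledE !mulrA.
Qed.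

Lemma row_marginal_sum u p a :
  row_marginal u p a = \sum_b value (scaled Gamma mu K u p) a b.
Proof. exact: rowsumE. Qed.

Lemma scaled_rev u p : is_arc E p ->
  value (scaled Gamma mu K u (rev_arc p)) = (value (scaled Gamma mu K u p))^T.
Proof.
move=> Ep; apply/matrixP => a b; rewrite [RHS]mxE !scaledE rev_arcK K_rev //.
by rewrite mxE /=; ring.
Qed.

Lemma row_marginal_rev u p b : is_arc E p ->
  row_marginal u (rev_arc p) b = \sum_a value (scaled Gamma mu K u p) a b.
Proof.
move=> Ep; rewrite row_marginal_sum scaled_rev //.
by apply: eq_bigr => a _; rewrite mxE.
Qed.

Lemma mass_rev u p : is_arc E p ->
  \sum_a row_marginal u (rev_arc p) a = \sum_a row_marginal u p a.
Proof.
move=> Ep; under eq_bigr do rewrite row_marginal_rev //.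
under [RHS]eq_bigr do rewrite row_marginal_sum.
exact: exchange_big.
Qed.

Lemma gam_ge0 j a : 0 <= gam j a 0.
Proof.
by rewrite /gamma_of; case: ifP => [/mu_prob[]|_] //; rewrite mxE ler01.
Qed.

Lemma gam_le1 j a : gam j a 0 <= 1.
Proof.
rewrite /gamma_of; case: ifP => [/mu_prob[m0 m1]|_]; last by rewrite mxE.
by rewrite -m1 (bigD1 a) //= lerDl sumr_ge0.
Qed.

Lemma gam_inner j a : j \notin Gamma -> gam j a 0 = 1.
Proof. by rewrite /gamma_of => /negPf->; rewrite mxE. Qed.

Lemma gam_leaf j a : j \in Gamma -> gam j a 0 = mu j a 0.
Proof. by rewrite /gamma_of => ->. Qed.

Lemma sum_gam_gt0 j : 0 < \sum_a gam j a 0.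
Proof.
rewrite /gamma_of; case: ifP => [/mu_prob[_ ->]|_] //.
under eq_bigr do rewrite mxE.
by rewrite sumr_const card_ord ltr0n.
Qed.

Lemma K_gt0 p a b : is_arc E p -> 0 < K p a b.
Proof. by move=> /K_bounds/(_ a b)/andP[/(lt_le_trans _)-> //];
  exact: expR_gt0. Qed.

(** * Invariants of the iteration *)

Definition positive u := forall p a, 0 < u p a 0.

(** The dual constraint at a node whose marginal is free. Only a constant vector is required, since
    normalized updates shift the logarithms by constants. *)
Definition balanced u := forall j, j \notin Gamma ->
  exists c, forall a, \sum_(k in nbr E j) ln (u (j, k) a 0) = c.

Definition bounded_log u := forall p, is_arc E p ->
  within (fun a => ln (u p a 0)) (2 * kap).

Definition regular u := [/\ positive u, balanced u & bounded_log u].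

Definition unit_mass u := forall p, is_arc E p ->
  \sum_a row_marginal u p a = 1.

Lemma sum_ugam_gt0 u p : positive u ->
  0 < \sum_b u (rev_arc p) b 0 * gam p.2 b 0.
Proof.
move=> u0; have := sum_gam_gt0 p.2.
have h0 a : 0 <= u (rev_arc p) a 0 * gam p.2 a 0.
  by rewrite mulr_ge0 ?gam_ge0 // ltW.
rewrite lt_neqAle => /andP[n0 _]; rewrite lt_neqAle sumr_ge0 // andbT.
apply: contra n0; rewrite eq_sym psumr_eq0 // => /allP h.
rewrite eq_sym psumr_eq0 => [|a _]; last exact: gam_ge0.
apply/allP => a /h; rewrite !implyTb mulf_eq0 => /orP[|//].
by rewrite gt_eqF.
Qed.

Lemma response_within u p : positive u -> is_arc E p ->
  within (fun a => ln (response u p a)) kap.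
Proof.
move=> u0 Ep; apply: within_ln_kernel; first exact: K_bounds.
  by move=> b; rewrite mulr_ge0 ?gam_ge0 // ltW.
exact: sum_ugam_gt0.
Qed.

Lemma response_gt0 u p a : positive u -> is_arc E p -> 0 < response u p a.
Proof.
move=> u0 Ep; apply: (@lt_le_trans _ _ (expR (- kap) * \sum_b u (rev_arc p) b 0
  * gam p.2 b 0)).
  by rewrite mulr_gt0 ?expR_gt0 ?sum_ugam_gt0.
rewrite mulr_sumr; apply: ler_sum => b _; rewrite ler_wpM2r //.
  by rewrite mulr_ge0 ?gam_ge0 // ltW.
by case/andP: (K_bounds Ep a b).
Qed.

Lemma scaled_ge0 u p a b : positive u -> is_arc E p ->
  0 <= value (scaled Gamma mu K u p) a b.
Proof.
move=> u0 Ep; rewrite scaledE.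
by rewrite !mulr_ge0 ?gam_ge0 ?(ltW (K_gt0 _ _ Ep)) // ltW.
Qed.

Lemma row_marginal_ge0 u p a : positive u -> is_arc E p ->
  0 <= row_marginal u p a.
Proof. by move=> *; rewrite row_marginal_sum sumr_ge0 // => *;
  exact: scaled_ge0. Qed.

Lemma row_marginal_gt0 u p a : positive u -> is_arc E p -> 0 < gam p.1 a 0 ->
  0 < row_marginal u p a.
Proof. by move=> u0 Ep g0; rewrite row_marginalE !mulr_gt0 // response_gt0. Qed.

Definition target u j (a : 'I_d) : R :=
  if j \in Gamma then mu j a 0
  else (\sum_(k in nbr E j) row_marginal u (j, k) a) / #|nbr E j|%:R.

Definition mismatch_sum u : R :=
  \sum_(p | is_arc E p) \sum_a `|row_marginal u p a - target u p.1 a|.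

Lemma mismatchE u : value (mismatch E Gamma mu K u) = mismatch_sum u.
Proof.
pose q := value (forC (is_arc E) (fun=> 0) (marginal Gamma mu K u)).
pose m := value (forC (mem (~: Gamma)) (fun=> 0) (average E q)).
have qE j k a : k \in nbr E j -> q (j, k) a 0 = row_marginal u (j, k) a.
  by rewrite /q /= mem_nbr_arc => ->.
rewrite -[LHS]/(\sum_(j | mem Gamma j) \sum_(k | mem (nbr E j) k)
    value (dist1 (q (j, k)) (mu j)) +
  \sum_(j | mem (~: Gamma) j) \sum_(k | mem (nbr E j) k)
    value (dist1 (q (j, k)) (m j))).
rewrite /mismatch_sum; under [RHS]eq_bigl do rewrite -[is_arc _ _]andbT.
rewrite (sum_arcs_nbr E _ predT) [RHS](bigID (mem Gamma)); congr (_ + _).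
  apply: eq_bigr => j jG; apply: eq_bigr => k kj; rewrite dist1E.
  by apply: eq_bigr => a _; rewrite qE // /target ifT.
apply: eq_big => [j|j jG]; first exact: (finset.in_setC j Gamma).
apply: eq_bigr => k kj; rewrite dist1E; apply: eq_bigr => a _.
rewrite qE // /target ifF; last by apply/negbTE; rewrite -finset.in_setC.
rewrite /m /= ifT // mxE /=; congr (`|_ - _ / _|).
by apply: eq_bigr => l lj; rewrite qE.
Qed.

Lemma mismatch_sum_ge0 u : 0 <= mismatch_sum u.
Proof. by rewrite sumr_ge0 // => p _; rewrite sumr_ge0. Qed.

Lemma target_sum u p : unit_mass u -> is_arc E p ->
  \sum_a target u p.1 a = 1.
Proof.
case: p => j k uM /= Ep; rewrite /target;
  case: (j \in Gamma) (@mu_prob j) => [/(_ isT)[]|_] //.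
rewrite -mulr_suml exchange_big /=.
have n0 : (0 < #|nbr E j|)%N.
  by apply/card_gt0P; exists k; rewrite mem_nbr_arc.
rewrite (eq_bigr (fun=> 1)) => [|l]; last by rewrite mem_nbr_arc => /uM.
by rewrite sumr_const divff // pnatr_eq0 -lt0n.
Qed.

(* A weight whose logarithms sum to a constant around [j] cannot distinguish
   two marginals of [j] of equal mass. *)
Lemma sum_balanced_eq (L : V * V -> 'I_d -> R) (nu nu' : V -> 'I_d -> R) :
  (forall j, j \notin Gamma ->
     exists c, forall a, \sum_(k in nbr E j) L (j, k) a = c) ->
  (forall j a, j \in Gamma -> nu j a = nu' j a) ->
  (forall p, is_arc E p -> \sum_a nu p.1 a = \sum_a nu' p.1 a) ->
  \sum_(p | is_arc E p) \sum_a L p a * nu p.1 a =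
  \sum_(p | is_arc E p) \sum_a L p a * nu' p.1 a.
Proof.
move=> hL eqG eqm.
under eq_bigl do rewrite -[is_arc _ _]andbT.
under [RHS]eq_bigl do rewrite -[is_arc _ _]andbT.
rewrite !(sum_arcs_nbr E _ predT); apply: eq_bigr => j _.
have [jG|jG] := boolP (j \in Gamma).
  by apply: eq_bigr => k _; apply: eq_bigr => a _; rewrite /= eqG.
rewrite exchange_big [RHS]exchange_big /=.
have [k kj|no_nbr] := pickP (mem (nbr E j)); last first.
  by apply: eq_bigr => a _; rewrite !big_pred0.
have [c hc] := hL j jG.
under eq_bigr do rewrite -mulr_suml hc.
under [RHS]eq_bigr do rewrite -mulr_suml hc.
rewrite -!mulr_sumr; congr (_ * _).
by apply: (eqm (j, k)); rewrite -mem_nbr_arc.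
Qed.

(** By balance [nu] may be exchanged for [target u], after which each arc pairs [L] with a zero-sum
    vector whose L1 norm is counted in the mismatch. It serves both the dual gap, with [L] a
    difference of potentials, and the primal cost, with [L] the potential itself. *)
Lemma sum_balanced_le u (L : V * V -> 'I_d -> R) (nu : V -> 'I_d -> R) r :
  (forall j, j \notin Gamma ->
     exists c, forall a, \sum_(k in nbr E j) L (j, k) a = c) ->
  (forall p, is_arc E p -> within (L p) r) ->
  (forall j a, j \in Gamma -> nu j a = mu j a 0) ->
  (forall p, is_arc E p -> \sum_a nu p.1 a = 1) ->
  unit_mass u ->
  \sum_(p | is_arc E p) \sum_a L p a * (row_marginal u p a - nu p.1 a)
    <= r * mismatch_sum u.
Proof.
move=> hL hr nuG num uM.
have -> : \sum_(p | is_arc E p) \sum_a L p a * (row_marginal u p a - nu p.1 a) =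
    \sum_(p | is_arc E p) \sum_a L p a * (row_marginal u p a - target u p.1 a).
  have -> : \sum_(p | is_arc E p) \sum_a L p a * (row_marginal u p a - nu p.1
    a) =
      \sum_(p | is_arc E p) \sum_a L p a * row_marginal u p a -
      \sum_(p | is_arc E p) \sum_a L p a * nu p.1 a.
    rewrite -sumrB; apply: eq_bigr => p _; rewrite -sumrB.
    by apply: eq_bigr => a _; rewrite mulrBr.
  rewrite (@sum_balanced_eq L nu (target u)) //; last 2 first.
  - by move=> j a jG; rewrite nuG // /target jG.
  - by move=> p Ep; rewrite num // target_sum.
  rewrite -sumrB; apply: eq_bigr => p _; rewrite -sumrB.
  by apply: eq_bigr => a _; rewrite mulrBr.
rewrite mulr_sumr; apply: ler_sum => p Ep; apply: within_pairing;
  first exact: hr.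
by rewrite sumrB uM // target_sum // subrr.
Qed.

(** * The dual objective *)

Section Dual.
Variable nu : V -> 'I_d -> R.
Hypothesis nu_leaf : forall j a, j \in Gamma -> nu j a = mu j a 0.
Hypothesis nu_mass : forall j, \sum_a nu j a = 1.

(* The entropic dual objective, up to the total mass, which stays constant. *)
Definition dual u : R :=
  \sum_(p | is_arc E p) \sum_a ln (u p a 0) * nu p.1 a.

Lemma dualB u v : dual v - dual u =
  \sum_(p | is_arc E p) \sum_a (ln (v p a 0) - ln (u p a 0)) * nu p.1 a.
Proof.
rewrite -sumrB; apply: eq_bigr => p _; rewrite -sumrB.
by apply: eq_bigr => a _; rewrite mulrBl.
Qed.

Lemma balancedB u v : balanced u -> balanced v -> forall j, j \notin Gamma ->
  exists c, forall a,
    \sum_(k in nbr E j) (ln (v (j, k) a 0) - ln (u (j, k) a 0)) = c.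
Proof.
move=> bu bv j jG; have [c hc] := bu j jG; have [e he] := bv j jG.
by exists (e - c) => a; rewrite sumrB hc he.
Qed.

(* Concavity of the dual objective, through [x <= expR x - 1]. *)
Lemma sum_log_ratio_le0 u v : positive u -> positive v ->
  unit_mass u -> unit_mass v ->
  \sum_(p | is_arc E p) \sum_a
     (ln (v p a 0) - ln (u p a 0)) * row_marginal u p a <= 0.
Proof.
move=> u0 v0 uM vM; rewrite sum_arcs_edges //.
pose D p a : R := ln (v p a 0) - ln (u p a 0).
apply: sumr_le0 => p /edge_is_arc Ep.
pose B := value (scaled Gamma mu K u p).
apply: (@le_trans _ _ (\sum_a \sum_b (D p a + D (rev_arc p) b) * B a b)).
  rewrite le_eqVlt; apply/orP; left; apply/eqP.
  transitivity (\sum_a \sum_b D p a * B a b + \sum_a \sum_b D (rev_arc p) b * B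
    a b).
    congr (_ + _).
      by apply: eq_bigr => a _; rewrite row_marginal_sum mulr_sumr.
    rewrite exchange_big /=; apply: eq_bigr => b _.
    by rewrite row_marginal_rev // mulr_sumr.
  rewrite -big_split /=; apply: eq_bigr => a _; rewrite -big_split /=.
  by apply: eq_bigr => b _; rewrite [RHS]mulrDl.
apply: (@le_trans _ _ (\sum_a \sum_b (value (scaled Gamma mu K v p) a b - B a
  b))).
  apply: ler_sum => a _; apply: ler_sum => b _.
  have -> : value (scaled Gamma mu K v p) a b =
      expR (D p a + D (rev_arc p) b) * B a b.
    rewrite /B !scaledE expRD !expRB !lnK ?posrE //.
    have := u0 p a; have := u0 (rev_arc p) b => ? ?.
    by field; rewrite !lt0r_neq0.
  rewrite -[X in _ <= _ - X]mul1r -mulrBl ler_wpM2r ?scaled_ge0 //.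
  by have := expR_ge1Dx (D p a + D (rev_arc p) b); lra.
have -> : \sum_a \sum_b (value (scaled Gamma mu K v p) a b - B a b) =
    \sum_a row_marginal v p a - \sum_a row_marginal u p a.
  rewrite -sumrB; apply: eq_bigr => a _.
  by rewrite !row_marginal_sum sumrB.
by rewrite uM // vM // subrr.
Qed.

(** Subtracting the nonpositive pairing of [ln v - ln u] with the marginals of [u] leaves
    [ln u - ln v] paired with their error. Each of the two potentials contributes [2 * kap]. The
    point [v] will be the last iterate considered. *)
Lemma dual_gap u v : regular u -> regular v -> unit_mass u -> unit_mass v ->
  dual v - dual u <= 4 * kap * mismatch_sum u.
Proof.
move=> [u0 bu lu] [v0 bv lv] uM vM; rewrite dualB.
pose L p (a : 'I_d) : R := ln (u p a 0) - ln (v p a 0).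
have h : \sum_(p | is_arc E p) \sum_a L p a * (row_marginal u p a - nu p.1 a)
    <= 4 * kap * mismatch_sum u.
  apply: sum_balanced_le => //; first exact: balancedB.
  move=> p Ep; apply: (within_le _ (withinD (lu p Ep) (withinN (lv p Ep)))).
  by lra.
apply: le_trans h; rewrite -subr_ge0.
have -> : \sum_(p | is_arc E p) \sum_a L p a * (row_marginal u p a - nu p.1 a) -
    \sum_(p | is_arc E p) \sum_a (ln (v p a 0) - ln (u p a 0)) * nu p.1 a =
    - \sum_(p | is_arc E p) \sum_a
       (ln (v p a 0) - ln (u p a 0)) * row_marginal u p a.
  rewrite -sumrB -sumrN; apply: eq_bigr => p _.
  by rewrite -sumrB -sumrN; apply: eq_bigr => a _; rewrite /L; ring.
by rewrite oppr_ge0; exact: sum_log_ratio_le0.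
Qed.

End Dual.

(** * One scaling iteration *)

Definition geo u j (a : 'I_d) : R :=
  (\prod_(k in nbr E j) row_marginal u (j, k) a) `^ (#|nbr E j|%:R^-1).

(** The marginal that an update imposes at [j], as opposed to [target], built from the arithmetic
    mean, against which the stopping test measures. *)
Definition fit u j (a : 'I_d) : R :=
  if j \in Gamma then mu j a 0 else geo u j a / \sum_b geo u j b.

Section Step.
Variables (S : {set V}) (u : vecs).
Hypothesis S_indep : forall p, is_arc E p -> p.1 \in S -> p.2 \notin S.
Hypothesis u_reg : regular u.

Let u' := value (bis_step E Gamma mu K S u).

Let u_gt0 : positive u. Proof. by case: u_reg. Qed.

Lemma nbr_gt0 p : is_arc E p -> (0 < #|nbr E p.1|)%N.
Proof. by case: p => j k Ep; apply/card_gt0P; exists k;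
  rewrite mem_nbr_arc. Qed.

Lemma geo_gt0 j a : j \notin Gamma -> 0 < geo u j a.
Proof.
move=> jG; rewrite powR_gt0 // prodr_gt0 // => k; rewrite mem_nbr_arc => Ep.
by rewrite row_marginal_gt0 //= gam_inner.
Qed.

Lemma sum_geo_gt0 j : j \notin Gamma -> 0 < \sum_b geo u j b.
Proof.
move=> jG; rewrite (bigD1 (Ordinal d_gt0)) //= ltr_pwDl ?geo_gt0 // sumr_ge0 //
  => a _.
by rewrite ltW ?geo_gt0.
Qed.

Lemma fit_gt0 j a : j \notin Gamma -> 0 < fit u j a.
Proof. by move=> jG; rewrite /fit (negPf jG) divr_gt0 ?geo_gt0 ?sum_geo_gt0.
  Qed.

Lemma fit_ge0 j a : 0 <= fit u j a.
Proof.
have [jG|/(fit_gt0 a)/ltW//] := boolP (j \in Gamma).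
by rewrite /fit jG; case: (mu_prob jG).
Qed.

Lemma fit_sum j : \sum_a fit u j a = 1.
Proof.
rewrite /fit; case: (boolP (j \in Gamma)) => [/mu_prob[]//|jG].
by rewrite -mulr_suml divff // gt_eqF ?sum_geo_gt0.
Qed.

Lemma bis_step_out p : ~~ arc_from E S p -> u' p = u p.
Proof. by move=> h; rewrite /u' /bis_step [LHS]/= (negPf h). Qed.

(** Both branches of the leaf update give the inverse response: the weight cancels where it is
    nonzero, and elsewhere the convention supplies [1 ./ (K u)], which is the inverse response
    because the neighbour of a leaf of [Gamma] has weight 1. *)
Lemma bis_step_in p a : arc_from E S p ->
  u' p a 0 = (if p.1 \in Gamma then 1 else fit u p.1 a) / response u p a.
Proof.
move=> Sp; have /andP[Ep pS] := Sp.
pose q := value (forC (arc_from E S) (fun=> 0) (marginal Gamma mu K u)).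
pose m := value (forC (mem (S :\: Gamma)) (fun=> 0) (fun j =>
              let* g := geomean E q j in normalize g)).
have qE k b : k \in nbr E p.1 -> q (p.1, k) b 0 = row_marginal u (p.1, k) b.
  by rewrite mem_nbr_arc => Ek; rewrite /q /= ifT // /arc_from /= Ek.
have qpE b : q p b 0 = row_marginal u p b by rewrite /q /= Sp.
have -> : u' p = value (if p.1 \in Gamma then update_leaf mu K u q p
    else update_inner u q m p).
  by rewrite /u' /bis_step -[LHS]/(if arc_from E S p then _ else _) Sp.
have up := u_gt0 p a; have rp := response_gt0 a u_gt0 Ep.
case: ifPn => pG; rewrite mxE.
  have pG2 : p.2 \notin Gamma.
    by apply: contraL Ep => pG2; exact: Gamma_nonadj.
  rewrite mul1r /=; case: eqVneq => [_|mu0] /=.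
    rewrite mul1r; congr (_^-1); apply: eq_bigr => b _.
    by rewrite gam_inner ?mulr1.
  by rewrite qpE row_marginalE gam_leaf //; field; rewrite mu0 !gt_eqF.
rewrite /= qpE row_marginalE gam_inner // mulr1.
have -> : m p.1 a 0 = fit u p.1 a.
  have pS' : p.1 \in S :\: Gamma by rewrite inE pG.
  have gE b : value (geomean E q p.1) b 0 = geo u p.1 b.
    by rewrite mxE; congr (_ `^ _); apply: eq_bigr => k /qE ->.
  rewrite -[m p.1]/(if p.1 \in S :\: Gamma
    then value (normalize (value (geomean E q p.1))) else 0) pS'.
  rewrite normalizeE /fit (negPf pG) gE; congr (_ / _); apply: eq_bigr => b _.
  by rewrite gE gtr0_norm // geo_gt0.
by field; rewrite !lt0r_neq0.
Qed.

(** The response reads only the potential of the reversed arc, whose origin lies outside [S]. *)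
Lemma response_step p : is_arc E p -> p.1 \in S ->
  response u' p =1 response u p.
Proof.
move=> Ep pS a; apply: eq_bigr => b _; rewrite bis_step_out //.
by rewrite /arc_from /= negb_and S_indep // orbT.
Qed.

Lemma positive_step : positive u'.
Proof.
move=> p a; have [Sp|Sp] := boolP (arc_from E S p);
  last by rewrite bis_step_out.
have /andP[Ep _] := Sp.
rewrite bis_step_in // divr_gt0 ?response_gt0 //.
by case: ifPn => // pG; exact: fit_gt0.
Qed.

Lemma row_marginal_step p a : arc_from E S p ->
  row_marginal u' p a = fit u p.1 a.
Proof.
move=> Sp; have /andP[Ep pS] := Sp.
rewrite row_marginalE response_step // bis_step_in //.
have rp := response_gt0 a u_gt0 Ep.
case: ifPn => pG; last by rewrite gam_inner // mulr1 divfK // lt0r_neq0.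
by rewrite /fit pG gam_leaf // mul1r mulrAC mulVf ?mul1r // lt0r_neq0.
Qed.

Lemma unit_mass_step : (forall p, is_arc E p -> (p.1 \in S) || (p.2 \in S)) ->
  unit_mass u'.
Proof.
move=> hS p Ep; have [pS|pS] := orP (hS p Ep).
  by under eq_bigr do rewrite row_marginal_step ?/arc_from ?Ep //;
    exact: fit_sum.
rewrite -mass_rev //.
under eq_bigr do rewrite row_marginal_step ?/arc_from ?rev_is_arc ?Ep //.
exact: fit_sum.
Qed.

Lemma ln_geo j a : j \notin Gamma -> ln (geo u j a) =
  #|nbr E j|%:R^-1 * \sum_(k in nbr E j)
     (ln (u (j, k) a 0) + ln (response u (j, k) a)).
Proof.
move=> jG; rewrite ln_powR; congr (_ * _); rewrite ln_prod.
  apply: eq_bigr => k; rewrite mem_nbr_arc => Ep.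
  rewrite row_marginalE gam_inner // mulr1 lnM // posrE //.
  exact: response_gt0.
move=> k; rewrite mem_nbr_arc => Ep.
by rewrite row_marginal_gt0 //= gam_inner.
Qed.

(* By balance the potentials cancel in the geometric mean up to a constant. *)
Lemma ln_fit j : j \notin Gamma -> exists c, forall a, ln (fit u j a) =
  #|nbr E j|%:R^-1 * (\sum_(k in nbr E j) ln (response u (j, k) a)) + c.
Proof.
move=> jG; case: u_reg => _ bu _; have [c hc] := bu j jG.
exists (#|nbr E j|%:R^-1 * c - ln (\sum_b geo u j b)) => a.
rewrite /fit (negPf jG) ln_div ?posrE ?geo_gt0 ?sum_geo_gt0 // ln_geo //.
by rewrite big_split /= hc; ring.
Qed.

Lemma ln_step p a : arc_from E S p -> ln (u' p a 0) =
  (if p.1 \in Gamma then 0 else ln (fit u p.1 a)) - ln (response u p a).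
Proof.
move=> Sp; have /andP[Ep _] := Sp; rewrite bis_step_in //.
have rp := response_gt0 a u_gt0 Ep.
case: ifPn => pG; rewrite ln_div ?posrE ?ltr01 ?fit_gt0 //.
by rewrite ln1.
Qed.

(** This is where the geometric mean matters: [ln (fit u j a)] is the average of the log responses
    up to a constant, so subtracting them around [j] leaves only a constant. *)
Lemma balanced_step : balanced u'.
Proof.
move=> j jG; have [jS|jS] := boolP (j \in S); last first.
  case: u_reg => _ bu _; have [c hc] := bu j jG; exists c => a; rewrite -(hc a).
  by apply: eq_bigr => k _; rewrite bis_step_out // /arc_from negb_and jS orbT.
have [c hc] := ln_fit jG; exists (#|nbr E j|%:R * c) => a.
transitivity (\sum_(k in nbr E j) (ln (fit u j a) - ln (response u (j, k) a))).
  apply: eq_bigr => k; rewrite mem_nbr_arc => Ep.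
  by rewrite ln_step ?(negPf jG) // /arc_from Ep.
rewrite sumrB sumr_const hc -[(_ + c) *+ _]mulr_natl mulrDr mulrA.
have [n0|n0] := eqVneq #|nbr E j| 0%N.
  rewrite n0 (cards0_eq n0) big_set0; ring.
by rewrite divff ?pnatr_eq0 // mul1r addrAC subrr add0r.
Qed.

(** A new potential is expressed by responses alone: one [kap] comes from the response divided out,
    another from the average of responses in [fit]. The bound is thus regenerated at each update
    instead of accumulating. *)
Lemma bounded_log_step : bounded_log u'.
Proof.
move=> p Ep; have [pS|pS] := boolP (p.1 \in S); last first.
  case: u_reg => _ _ lu; apply: (eq_within _ (lu p Ep)) => a.
  by rewrite bis_step_out // /arc_from negb_and pS orbT.
have Sp : arc_from E S p by rewrite /arc_from Ep.
have wr := withinN (response_within u_gt0 Ep).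
have [pG|pG] := boolP (p.1 \in Gamma).
  apply: (@eq_within _ _ (fun a => - ln (response u p a))) => [a|].
    by rewrite ln_step // pG sub0r.
  by apply: (within_le _ wr); rewrite ler_peMl ?ler1n.
have [c hc] := ln_fit pG.
apply: (@eq_within _ _ (fun a => (#|nbr E p.1|%:R^-1 *
   (\sum_(k in nbr E p.1) ln (response u (p.1, k) a)) + c) - ln (response u p
     a))) => [a|].
  by rewrite ln_step // (negPf pG) hc.
have wm : within (fun a => #|nbr E p.1|%:R^-1 *
    (\sum_(k in nbr E p.1) ln (response u (p.1, k) a))) kap.
  apply: within_mean; first exact: nbr_gt0.
  by move=> k kj; apply: response_within => //; rewrite -mem_nbr_arc.
apply: (within_le _ (withinD (withinD wm (within_cst _ c)) wr)).
by lra.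
Qed.

Lemma regular_step : regular u'.
Proof. split; [exact: positive_step | exact: balanced_step | exact:
  bounded_log_step]. Qed.

Lemma target_step p a : arc_from E S p -> target u' p.1 a = fit u p.1 a.
Proof.
move=> Sp; have /andP[Ep pS] := Sp; rewrite /target /fit.
case: ifPn => pG //.
rewrite (eq_bigr (fun=> fit u p.1 a)) => [|k]; last first.
  by rewrite mem_nbr_arc => Ek; rewrite row_marginal_step // /arc_from Ek.
rewrite sumr_const -[fit _ _ _ *+ _]mulr_natr mulfK;
  first by rewrite /fit (negPf pG).
by rewrite pnatr_eq0 -lt0n nbr_gt0.
Qed.

Lemma fitted_step p a : arc_from E S p -> row_marginal u' p a = target u' p.1 a.
Proof. by move=> Sp; rewrite target_step ?row_marginal_step. Qed.

(** * Dual increase in one iteration *)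

Section Increase.
Variable nu : V -> 'I_d -> R.
Hypothesis nu_leaf : forall j a, j \in Gamma -> nu j a = mu j a 0.
Hypothesis nu_mass : forall j, \sum_a nu j a = 1.
Hypothesis u_mass : unit_mass u.
Hypothesis u_fitted : forall p, is_arc E p -> p.1 \notin S ->
  forall a, row_marginal u p a = target u p.1 a.

(** The relative entropy of [fit] with respect to the current row marginal, written with potentials
    so that it makes sense where the marginals vanish; such coordinates have zero weight. *)
Definition divergence p : R :=
  \sum_a fit u p.1 a * (ln (u' p a 0) - ln (u p a 0)).

(** The increment of the potentials is balanced, so [nu] may be replaced by the marginals [fit u]
    imposed by the step; arcs not leaving [S] have zero increment. *)
Lemma dual_step : dual nu u' - dual nu u = \sum_(p | arc_from E S p) divergence
  p.
Proof.
rewrite dualB (sum_balanced_eq (nu' := fit u)); first last.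
- by move=> p _; rewrite nu_mass fit_sum.
- by move=> j a jG; rewrite nu_leaf // /fit jG.
- by apply: balancedB; [case: u_reg | exact: balanced_step].
rewrite (bigID (fun p => p.1 \in S)) /= [X in _ + X]big1 ?addr0 =>
  [|p /andP[Ep pS]].
  by apply: eq_bigr => p _; apply: eq_bigr => a _; rewrite mulrC.
apply: big1 => a _; rewrite bis_step_out ?subrr ?mul0r //.
by rewrite /arc_from negb_and pS orbT.
Qed.

Lemma divergence_ge p (lam : R) : arc_from E S p -> 0 < lam ->
  \sum_a `|row_marginal u p a - fit u p.1 a| <= lam / 2 * divergence p + 2 /
    lam.
Proof.
move=> Sp lam0; have /andP[Ep pS] := Sp.
under eq_bigr do rewrite distrC.
apply: kl_lower_bound => //.
- exact: fit_ge0.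
- by move=> a; exact: row_marginal_ge0.
- move=> a f0; have rp := response_gt0 a u_gt0 Ep.
  have g0 : 0 < gam p.1 a 0.
    have [pG|pG] := boolP (p.1 \in Gamma); last by rewrite gam_inner.
    by move: f0; rewrite gam_leaf // /fit pG.
  split; first exact: row_marginal_gt0.
  rewrite ln_step // row_marginalE !lnM ?posrE ?mulr_gt0 //.
  have [pG|pG] := boolP (p.1 \in Gamma); last by rewrite gam_inner // ln1; ring.
  by rewrite gam_leaf // {1}/fit pG; ring.
- exact: fit_sum.
- exact: u_mass.
Qed.

(** Around an inner node, the arithmetic mean is at most as far from any vector [f] as the marginals
    are on average, so by the triangle inequality replacing [f] by the mean at most doubles the
    total distance. *)
Lemma mismatch_le_fit : mismatch_sum u <=
  2 * \sum_(p | arc_from E S p) \sum_a `|row_marginal u p a - fit u p.1 a|.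
Proof.
rewrite /mismatch_sum (bigID (fun p => p.1 \in S)) /= [X in _ + X]big1 =>
  [|p /andP[Ep pS]]; last first.
  by apply: big1 => a _; rewrite u_fitted // subrr normr0.
rewrite addr0 !(sum_arcs_nbr E _ (mem S)) mulr_sumr; apply: ler_sum => j _ /=.
rewrite exchange_big [in X in _ <= _ * X]exchange_big mulr_sumr /=.
apply: ler_sum => a _; rewrite /target /fit.
have [jG|jG] := boolP (j \in Gamma).
  by rewrite -[X in X <= _]mul1r ler_wpM2r ?ler1n // sumr_ge0.
set f := geo u j a / _; set n := #|nbr E j|;
  set s := \sum_(k in _) row_marginal u _ a.
pose D := \sum_(k in nbr E j) `|row_marginal u (j, k) a - f|.
apply: (@le_trans _ _ (\sum_(k in nbr E j) (`|row_marginal u (j, k) a - f| +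
  `|f - s / n%:R|))).
  apply: ler_sum => k _; apply: le_trans (ler_normD _ _).
  by rewrite addrA subrK.
rewrite big_split /= -/D sumr_const mulr_natl mulr2n lerD2l -/n.
have [->|n0] := eqVneq n 0%N; first by rewrite mulr0n sumr_ge0.
have np : 0 < n%:R :> R by rewrite ltr0n lt0n.
rewrite -[`|_| *+ _]mulr_natl -{1}[n%:R]gtr0_norm // -normrM mulrBr.
rewrite [n%:R * (s / _)]mulrC [s / _ * _]divfK ?lt0r_neq0 // distrC mulr_natl.
by rewrite -sumr_const -sumrB ler_norm_sum.
Qed.

Lemma card_arc_from : #|arc_from E S|%:R <= #|E|%:R :> R.
Proof.
rewrite -!sumr_const big_mkcondr sum_arcs_edges //;
  apply: ler_sum => p /edge_is_arc Ep.
case: ifPn => [pS|_]; last by rewrite add0r; case: ifP => _; rewrite ?ler01.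
by rewrite ifF ?addr0 //; apply/negbTE; exact: S_indep.
Qed.

(** Summing the bounds over the arcs leaving [S], at most one per edge, gives
    [m <= lam * D + 4 |E| / lam] for the dual increase [D] and every [lam]; optimizing [lam]
    produces the factor [4 * 4 |E|]. *)
Lemma mismatch_sqr_le : (0 < #|E|)%N -> mismatch_sum u ^+ 2 <=
  16 * #|E|%:R * (dual nu u' - dual nu u).
Proof.
move=> E0; have c0 : 0 < 4 * #|E|%:R :> R by rewrite mulr_gt0 // ltr0n.
rewrite (_ : 16 * _ = 4 * (4 * #|E|%:R)); last by ring.
apply: sqr_le_of_young => //; first exact: mismatch_sum_ge0.
move=> lam lam0; apply: (le_trans mismatch_le_fit); rewrite dual_step.
apply: (@le_trans _ _ (2 * \sum_(p | arc_from E S p) (lam / 2 * divergence p +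
  2 / lam))).
  by rewrite ler_pM2l //; apply: ler_sum => p Sp; exact: divergence_ge.
rewrite big_split /= -mulr_sumr sumr_const -[_ / _ *+ _]mulr_natr.
rewrite (_ : 2 * _ = lam * (\sum_(p | arc_from E S p) divergence p)
  + 4 * #|arc_from E S|%:R / lam); last by field; rewrite lt0r_neq0.
by rewrite lerD2l ler_pM2r ?invr_gt0 // ler_pM2l // card_arc_from.
Qed.

End Increase.

End Step.

End Dynamics.

(** * Cost of the rounded solution *)

Section Approximation.
Variables (R : realType) (V : finType) (E : {set V * V}) (d : nat).
Variables (Gamma : {set V}) (mu : V -> 'cV[R]_d) (C : V * V -> 'M[R]_d).
Variable eps : R.

Implicit Types (u : V * V -> 'cV[R]_d) (p : V * V) (S : {set V}).

Hypothesis d_gt1 : (1 < d)%N.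
Hypothesis E_tree : is_tree E.
Hypothesis Gamma_neq0 : (0 < #|Gamma|)%N.
Hypothesis Gamma_leaves : nonadjacent_leaves E Gamma.
Hypothesis mu_prob : forall j, j \in Gamma -> is_prob (mu j).
Hypothesis C_rev : forall p, is_arc E p -> C (rev_arc p) = (C p)^T.
Hypothesis eps_gt0 : 0 < eps.

Let d_gt0 : (0 < d)%N := ltnW d_gt1.
Let E_asym : forall j k, (j, k) \in E -> (k, j) \notin E.
Proof. by case: E_tree. Qed.
Let Gamma_nonadj :
  forall j k, j \in Gamma -> k \in Gamma -> ~~ adj E j k.
Proof. by case: Gamma_leaves. Qed.

Local Notation gam := (gamma_of Gamma mu).

Lemma sum_rowE (A : 'M[R]_d) a : (A *m const_mx 1 : 'cV_d) a 0 = \sum_b A a b.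
Proof. by rewrite mxE; apply: eq_bigr => b _; rewrite mxE mulr1. Qed.

Lemma Cinf_ge0 : 0 <= Cinf E C.
Proof. by apply: bigmax_ge_id. Qed.

Lemma C_le_Cinf p a b : is_arc E p -> `|C p a b| <= Cinf E C.
Proof.
have h q a' b' : q \in E -> `|C q a' b'| <= Cinf E C.
  move=> qE; rewrite /Cinf (bigD1 q) //= le_max (bigD1 a') //= le_max.
  by rewrite (bigD1 b') //= le_max lexx.
move=> Ep; have := Ep; rewrite /is_arc /adj => /orP[|] pE.
  by apply: h; rewrite [p]surjective_pairing.
by rewrite -[p]rev_arcK C_rev ?rev_is_arc // mxE h.
Qed.

Definition gibbs : V * V -> 'M[R]_d := value (gibbs_kernel E C eps).

Lemma gibbsE p a b : is_arc E p -> gibbs p a b = expR (- (C p a b / eps)).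
Proof. by move=> Ep; rewrite /gibbs /= Ep mxE. Qed.

Lemma gibbs_rev p : is_arc E p -> gibbs (rev_arc p) = (gibbs p)^T.
Proof.
move=> Ep; apply/matrixP => a b; rewrite mxE !gibbsE ?rev_is_arc //.
by rewrite C_rev // mxE.
Qed.

Lemma gibbs_bounds p : is_arc E p -> forall a b,
  expR (- (Cinf E C / eps)) <= gibbs p a b <= expR (Cinf E C / eps).
Proof.
move=> Ep a b; rewrite gibbsE // !ler_expR lerN2 -mulNr !ler_pM2r ?invr_gt0 //.
by have := C_le_Cinf a b Ep; rewrite ler_norml => /andP[? ?]; apply/andP;
  split; lra.
Qed.

Local Notation row_marginal := (row_marginal Gamma mu gibbs).
Local Notation scaled_mx u p := (value (scaled Gamma mu gibbs u p)).
Local Notation mismatch_sum := (mismatch_sum E Gamma mu gibbs).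
Local Notation target := (target E Gamma mu gibbs).
Local Notation unit_mass := (unit_mass E Gamma mu gibbs).
Local Notation regular := (regular E Gamma (Cinf E C / eps)).

(** * Comparison with a feasible point *)

Section Feasible.
Variables (B : V * V -> 'M[R]_d) (nu : V -> 'cV[R]_d).
Hypothesis B_feas : feasible E Gamma mu B nu.

Let B_ge0 p a b : p \in E -> 0 <= B p a b.
Proof. by case: B_feas => _ h /h[]. Qed.

Let B_row p a : p \in E -> \sum_b B p a b = nu p.1 a 0.
Proof. by case: B_feas => _ h /h[_ <- _]; rewrite sum_rowE. Qed.

Let B_col p b : p \in E -> \sum_a B p a b = nu p.2 b 0.
Proof.
case: B_feas => _ h /h[_ _ <-]; rewrite sum_rowE.
by apply: eq_bigr => a _; rewrite mxE.
Qed.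

(** The two ends of an edge carry equal mass, so the unit mass of a leaf in [Gamma] propagates along
    paths of the connected tree. *)
Lemma feasible_mass j : \sum_a nu j a 0 = 1.
Proof.
have step i k : adj E i k -> \sum_a nu i a 0 = \sum_a nu k a 0.
  have h l m : (l, m) \in E -> \sum_a nu l a 0 = \sum_a nu m a 0.
    move=> lm; under eq_bigr do rewrite -(B_row _ lm).
    under [RHS]eq_bigr do rewrite -(B_col _ lm).
    exact: exchange_big.
  by case/orP => /h.
have [i iG] := card_gt0P Gamma_neq0.
have [_ conn _] := E_tree; have /connectP[s] := conn i j.
have : \sum_a nu i a 0 = 1.
  by case: B_feas => -> // _; case: (mu_prob iG).
elim: s i {iG} => [|k s IH] i i1 /=; first by move=> _ ->.
by move=> /andP[/step ik ks]; apply: IH => //; rewrite -ik.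
Qed.

(** An entry is at most either of its marginals. At most one end of the edge lies in [Gamma], so the
    product of weights is that leaf's marginal or 1. *)
Lemma feasible_le_gam p a b : p \in E -> B p a b <= gam p.1 a 0 * gam p.2 b 0.
Proof.
move=> pE; have [nuG _] := B_feas.
have Br : B p a b <= nu p.1 a 0.
  by rewrite -B_row // (bigD1 b) //= lerDl sumr_ge0 // => *; exact: B_ge0.
have Bc : B p a b <= nu p.2 b 0.
  by rewrite -B_col // (bigD1 a) //= lerDl sumr_ge0 // => *; exact: B_ge0.
have nu1 : nu p.1 a 0 <= 1.
  rewrite -(feasible_mass p.1) (bigD1 a) //= lerDl sumr_ge0 // => a' _.
  by rewrite -B_row // sumr_ge0 // => *; exact: B_ge0.
have [p1G|p1G] := boolP (p.1 \in Gamma).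
  rewrite gam_leaf // gam_inner ?mulr1 -?nuG //.
  by apply: contraL (edge_is_arc pE); exact: Gamma_nonadj.
rewrite gam_inner // mul1r.
have [p2G|p2G] := boolP (p.2 \in Gamma); first by rewrite gam_leaf // -nuG.
by rewrite gam_inner // (le_trans Br).
Qed.

(** The two potential terms of [C] see only the marginals of the difference of the plans; what
    remains is [entropy_gap] over [d * d] entries, whence [eps * ln (d * d)]. *)
Lemma edge_cost_le u p : positive u -> unit_mass u -> p \in E ->
  inner (C p) (scaled_mx u p) - inner (C p) (B p) <=
  eps * (\sum_a ln (u p a 0) * (row_marginal u p a - nu p.1 a 0) +
         \sum_b ln (u (rev_arc p) b 0) *
           (row_marginal u (rev_arc p) b - nu p.2 b 0)) +
  2 * eps * ln d%:R.
Proof.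
move=> u0 uM pE; have Ep := edge_is_arc pE.
pose x a := ln (u p a 0); pose y b := ln (u (rev_arc p) b 0).
(* The weights [W] are kept out of [M], so that [ln (M i)] is meaningful even where a leaf marginal
   vanishes. *)
pose M (i : 'I_d * 'I_d) := u p i.1 0 * gibbs p i.1 i.2 * u (rev_arc p) i.2 0.
pose W (i : 'I_d * 'I_d) := gam p.1 i.1 0 * gam p.2 i.2 0.
pose P (i : 'I_d * 'I_d) := B p i.1 i.2.
have M0 i : 0 < M i by rewrite !mulr_gt0 // gibbsE // expR_gt0.
have WM i : W i * M i = scaled_mx u p i.1 i.2.
  by rewrite /W /M scaledE; ring.
have gap : \sum_i (P i - W i * M i) * ln (M i) <= 2 * ln d%:R.
  have -> : 2 * ln d%:R = ln #|{: 'I_d * 'I_d}|%:R :> R.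
    by rewrite card_prod !card_ord natrM lnM ?posrE ?ltr0n // mulr_natl mulr2n.
  apply: entropy_gap => [|i|//||i|].
  - by rewrite card_prod !card_ord muln_gt0 d_gt0.
  - by rewrite mulr_ile1 // ?gam_ge0 ?gam_le1.
  - rewrite -(uM p Ep) -(pair_bigA _ (fun a b => W (a, b) * M (a, b))) /=.
    apply: eq_bigr => a _; rewrite row_marginal_sum; apply: eq_bigr => b _.
    exact: WM.
  - by rewrite B_ge0 //= feasible_le_gam.
  - rewrite -(pair_bigA _ (fun a b => P (a, b))) -(feasible_mass p.1) /=.
    by apply: eq_bigr => a _; rewrite -B_row.
have CE a b : C p a b = eps * (x a + y b - ln (M (a, b))).
  rewrite /M !lnM ?posrE ?mulr_gt0 ?gibbsE ?expR_gt0 //= expRK /x /y.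
  by field; rewrite lt0r_neq0.
rewrite -(pair_bigA _ (fun a b =>
  (P (a, b) - W (a, b) * M (a, b)) * ln (M (a, b)))) /= in gap.
have -> : inner (C p) (scaled_mx u p) - inner (C p) (B p) =
  eps * (\sum_a x a * (row_marginal u p a - nu p.1 a 0) +
         \sum_b y b * (row_marginal u (rev_arc p) b - nu p.2 b 0)) +
  eps * \sum_a \sum_b (P (a, b) - W (a, b) * M (a, b)) * ln (M (a, b)).
  have -> : \sum_a x a * (row_marginal u p a - nu p.1 a 0) =
      \sum_a \sum_b x a * (scaled_mx u p a b - B p a b).
    by apply: eq_bigr => a _; rewrite -mulr_sumr sumrB row_marginal_sum B_row.
  have -> : \sum_b y b * (row_marginal u (rev_arc p) b - nu p.2 b 0) =
      \sum_a \sum_b y b * (scaled_mx u p a b - B p a b).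
    rewrite exchange_big; apply: eq_bigr => b _; rewrite -mulr_sumr sumrB.
    by rewrite (row_marginal_rev Gamma mu gibbs_rev) ?B_col // edge_is_arc.
  rewrite -mulrDr -!big_split mulr_sumr /inner -sumrB /=; apply: eq_bigr => a _.
  rewrite -!big_split mulr_sumr -sumrB /=; apply: eq_bigr => b _.
  by rewrite CE WM /P /=; ring.
by rewrite lerD2l -mulrA mulrCA ler_pM2l.
Qed.

(** Potentials oscillate on the scale [Cinf / eps], so the prefactor [eps] cancels and the mismatch
    is charged at a rate free of [eps]. *)
Lemma objective_le u : regular u -> unit_mass u ->
  objective E C (fun p => scaled_mx u p) - objective E C B <=
  2 * eps * #|E|%:R * ln d%:R + 2 * Cinf E C * mismatch_sum u.
Proof.
move=> [u0 bu lu] uM; rewrite /objective -sumrB.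
apply: (le_trans (ler_sum _ (fun p pE => edge_cost_le u0 uM pE))).
rewrite big_split /= -mulr_sumr sumr_const addrC.
rewrite -[_ *+ _]mulr_natr mulrAC lerD2l.
rewrite -(@sum_arcs_edges V E R (fun p => \sum_a ln (u p a 0) *
  (row_marginal u p a - nu p.1 a 0))) //.
have [nuG _] := B_feas.
rewrite -ler_pdivlMl // (_ : _^-1 * _ = 2 * (Cinf E C / eps) * mismatch_sum u).
  apply: (sum_balanced_le mu_prob (L := fun p a => ln (u p a 0))
    (nu := fun j a => nu j a 0)) => //.
    by move=> j a /nuG ->.
  by move=> p _; exact: feasible_mass.
by rewrite [LHS]mulrA; ring.
Qed.

End Feasible.

(** * Feasibility and cost after rounding *)

Section RoundOutput.
Variables (S : {set V}) (u : V * V -> 'cV[R]_d).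
Hypothesis S_cut : forall p, is_arc E p -> (p.1 \in S) = (p.2 \notin S).
Hypothesis u_gt0 : positive u.
Hypothesis u_mass : unit_mass u.
Hypothesis u_fitted : forall p, is_arc E p -> p.1 \notin S ->
  forall a, row_marginal u p a = target u p.1 a.

Let B : V * V -> 'M[R]_d :=
  value (forC (is_arc E) (fun=> 0) (scaled Gamma mu gibbs u)).
Let Bh := value (rounding E Gamma mu S B).

Let BE p : is_arc E p -> B p = scaled_mx u p.
Proof. by rewrite /B /= => ->. Qed.

Lemma rounding_in p : arc_from E S p ->
  [/\ forall a b, 0 <= Bh p a b,
      forall a, \sum_b Bh p a b = target u p.1 a,
      forall b, \sum_a Bh p a b = row_marginal u (rev_arc p) b
    & \sum_a \sum_b `|Bh p a b - scaled_mx u p a b| <=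
      \sum_a `|row_marginal u p a - target u p.1 a|].
Proof.
move=> Sp; have /andP[Ep pS] := Sp.
pose q := value (forC (arc_from E S) (fun=> 0) (fun p => rowsum (B p))).
pose m := value (forC (mem (S :\: Gamma)) (fun=> 0) (average E q)).
pose r := if p.1 \in Gamma then mu p.1 else m p.1.
have rE a : r a 0 = target u p.1 a.
  rewrite /r /target; have [//|pG] := boolP (p.1 \in Gamma).
  rewrite -[m p.1]/(if p.1 \in S :\: Gamma then value (average E q p.1) else 0).
  rewrite ifT ?inE ?pG // mxE; congr (_ / _); apply: eq_bigr => k.
  rewrite -[X in is_true X -> _]/(k \in nbr E p.1) mem_nbr_arc => Ek.
  rewrite /q /= /arc_from Ek pS /= -/(value (rowsum (B (p.1, k)))) BE //.
have -> : Bh p = value (Round (scaled_mx u p) r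
    (value (colsum (scaled_mx u p)))).
  rewrite -[LHS]/(if p.1 \in S then if arc_from E S p then
    value (Round (B p) r (value (colsum (B p)))) else 0 else _).
  by rewrite pS Sp BE.
have [|||h1 h2 h3 h4] := @RoundP R d (scaled_mx u p) r.
- by move=> a b; apply: scaled_ge0 gibbs_bounds _ _ _ _ _ _.
- move=> a; rewrite rE /target; have [pG|_] := boolP (p.1 \in Gamma).
    by case: (mu_prob pG).
  rewrite divr_ge0 ?sumr_ge0 // => k; rewrite mem_nbr_arc => Ek.
  exact: row_marginal_ge0 gibbs_bounds _ _ _ _ _.
- rewrite (eq_bigr _ (fun a _ => rE a)) target_sum // -(u_mass Ep).
  by apply: eq_bigr => a _; rewrite row_marginal_sum.
split=> // [a|b|]; first by rewrite h2.
- by rewrite h3 (row_marginal_rev Gamma mu gibbs_rev).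
- apply: (le_trans h4); rewrite le_eqVlt; apply/orP; left; apply/eqP.
  by apply: eq_bigr => a _; rewrite rE row_marginal_sum.
Qed.

Lemma rounding_out p : is_arc E p -> p.1 \notin S ->
  Bh p = (Bh (rev_arc p))^T /\ arc_from E S (rev_arc p).
Proof.
move=> Ep pS; have pS2 : p.2 \in S by rewrite -[_ \in S]negbK -S_cut.
split; last by rewrite /arc_from rev_is_arc Ep.
rewrite -[LHS]/(if p.1 \in S then _ else _) (negPf pS); congr (_ ^T).
by rewrite -[RHS]/(if p.2 \in S then _ else _) pS2.
Qed.

(** The common node marginals are [target u]: rounding imposes them on the [S] side and preserves
    the column sums, which already equal them on the other side. *)
Lemma rounding_feasible :
  feasible E Gamma mu Bh (fun j => \col_a target u j a).
Proof.
split=> [j jG|p pE]; first by apply/colP => a; rewrite mxE /target jG.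
have Ep := edge_is_arc pE; have Er : is_arc E (rev_arc p) by rewrite rev_is_arc.
have [pS|pS] := boolP (p.1 \in S).
  have Sp : arc_from E S p by rewrite /arc_from Ep.
  have [h1 h2 h3 _] := rounding_in Sp; split=> //; apply/colP => a.
    by rewrite sum_rowE h2 mxE.
  rewrite sum_rowE mxE -(u_fitted Er) /=; last by rewrite -S_cut.
  by rewrite -h3; apply: eq_bigr => b _; rewrite mxE.
have [-> Sr] := rounding_out Ep pS.
have [h1 h2 h3 _] := rounding_in Sr; split=> [a b||].
- by rewrite mxE.
- apply/colP => a; rewrite sum_rowE mxE -(u_fitted Ep) //.
  by rewrite -{2}[p]rev_arcK -h3; apply: eq_bigr => b _; rewrite mxE.
- by apply/colP => a; rewrite trmxK sum_rowE h2 mxE.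
Qed.

Lemma inner_diff_le (A X Y : 'M[R]_d) (c : R) : (forall a b, `|A a b| <= c) ->
  inner A X - inner A Y <= c * \sum_a \sum_b `|X a b - Y a b|.
Proof.
move=> hA; rewrite /inner -sumrB mulr_sumr; apply: ler_sum => a _.
rewrite -sumrB mulr_sumr; apply: ler_sum => b _.
by rewrite -mulrBr (le_trans (ler_norm _)) // normrM ler_wpM2r.
Qed.

(** On each edge only the orientation leaving [S] is rounded, so the change is charged to the
    mismatch of that arc alone. *)
Lemma rounding_objective :
  objective E C Bh - objective E C (fun p => scaled_mx u p) <=
  Cinf E C * mismatch_sum u.
Proof.
rewrite /objective -sumrB /mismatch_sum sum_arcs_edges // mulr_sumr.
apply: ler_sum => p pE; have Ep := edge_is_arc pE.
apply: (le_trans (inner_diff_le _ _ (fun a b => C_le_Cinf a b Ep))).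
rewrite ler_wpM2l ?Cinf_ge0 //.
have [pS|pS] := boolP (p.1 \in S).
  have Sp : arc_from E S p by rewrite /arc_from Ep.
  have [_ _ _ h] := rounding_in Sp.
  by apply: (le_trans h); rewrite lerDl sumr_ge0.
have [-> Sr] := rounding_out Ep pS; have [_ _ _ h] := rounding_in Sr.
rewrite exchange_big /= (le_trans _ (le_trans h _)) //;
  last by rewrite lerDr sumr_ge0.
rewrite le_eqVlt; apply/orP; left; apply/eqP.
apply: eq_bigr => b _; apply: eq_bigr => a _;
  rewrite (scaled_rev _ _ gibbs_rev) //.
by rewrite [X in `|X - _| = _]mxE [X in _ = `|_ - X|]mxE.
Qed.

(** Every feasible point is compared, so the infimum is bounded without a minimizer. Of the factor
    3, two units come from the scaling and one from the rounding. *)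
Lemma rounding_approx (delta : R) : regular u ->
  2 * eps * #|E|%:R * ln d%:R + 3 * Cinf E C * mismatch_sum u <= delta ->
  approx_solution E Gamma mu C delta Bh.
Proof.
move=> u_reg hdelta; split; first by eexists; exact: rounding_feasible.
rewrite -leeBlDr //; apply: le_ereal_inf_tmp => _ [B' [nu [feas ->]]].
rewrite leeBlDr // -EFinD lee_fin.
have := objective_le feas u_reg u_mass; have := rounding_objective.
lra.
Qed.

End RoundOutput.

End Approximation.

(** * Operation counts *)

Section OperationCounts.
Variables (R : realType) (V : finType) (E : {set V * V}) (d : nat).
Variables (Gamma : {set V}) (mu : V -> 'cV[R]_d) (C : V * V -> 'M[R]_d).
Implicit Types (F : 'M[R]_d) (S : {set V}) (K : V * V -> 'M[R]_d).
Implicit Types (u q : V * V -> 'cV[R]_d) (p : V * V).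

Local Open Scope nat_scope.

Hypothesis d_gt0 : 0 < d.
Hypothesis E_gt0 : 0 < #|E|.
Hypothesis nbr_neq0 : forall j, 0 < #|nbr E j|.

Lemma ops_bind (A A' : Type) (m : counted A) (f : A -> counted A') :
  ops (bind m f) = ops m + ops (f (value m)).
Proof. by []. Qed.

Lemma ops_colC_le k (F : 'I_d -> counted R) :
  (forall a, ops (F a) <= k) -> ops (colC F) <= d * k.
Proof.
move=> h; apply: (@leq_trans (\sum_(a < d) k)); first exact: leq_sum.
by rewrite sum_nat_const card_ord.
Qed.

Lemma ops_mxC_le k (F : 'I_d -> 'I_d -> counted R) :
  (forall a b, ops (F a b) <= k) -> ops (mxC F) <= d * (d * k).
Proof.
move=> h; apply: (@leq_trans (\sum_(a < d) \sum_(b < d) k)).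
  by apply: leq_sum => a _; exact: leq_sum.
by rewrite !sum_nat_const card_ord.
Qed.

Lemma ops_bigC_le (T : Type) (I : finType) (acc : T -> T -> T) z (P : pred I)
    (F : I -> counted T) k :
  (forall i, P i -> ops (F i) <= k) -> ops (bigC acc z P F) <= #|P| * k.+1.
Proof.
move=> h; apply: (@leq_trans (\sum_(i | P i) k.+1)); first exact: leq_sum.
by rewrite sum_nat_const.
Qed.

Lemma ops_forC_le (T : Type) (I : finType) (P : pred I) (old : I -> T)
    (F : I -> counted T) k :
  (forall i, P i -> ops (F i) <= k) -> ops (forC P old F) <= #|P| * k.
Proof.
move=> h; apply: (@leq_trans (\sum_(i | P i) k)); first exact: leq_sum.
by rewrite sum_nat_const.
Qed.

Lemma card_is_arc_le : #|is_arc E| <= 2 * #|E|.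
Proof.
have cardr : #|[set rev_arc p | p in E]| = #|E|.
  exact: (card_imset _ (can_inj (@rev_arcK V))).
rewrite mul2n -addnn -{2}cardr -cardsUI.
apply: leq_trans (leq_addr _ _);
  apply/subset_leq_card/fintype.subsetP => -[j k] /orP[|] jk.
  by rewrite inE jk.
by rewrite inE orbC -[(j, k)]rev_arcK imset_f.
Qed.

Lemma card_arc_from_le S : #|arc_from E S| <= 2 * #|E|.
Proof.
apply: leq_trans card_is_arc_le; apply/subset_leq_card/fintype.subsetP => p.
by case/andP.
Qed.

(** Handshake count: costs proportional to the degree add up to a multiple of [2 * #|E|]. As no node
    is isolated, a fixed cost per node can be charged to its degree as well. *)
Lemma sum_nbr_le (P : pred V) (f : V -> nat) k :
  (forall j, P j -> f j <= k * #|nbr E j|) -> \sum_(j | P j) f j <= k * (2 *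
    #|E|).
Proof.
move=> h; apply: (@leq_trans (\sum_j k * #|nbr E j|)).
  rewrite big_mkcond; apply: leq_sum => j _; case: ifP => // Pj; exact: h.
rewrite -big_distrr leq_mul2l; apply/orP; right.
apply: leq_trans card_is_arc_le; rewrite -sum1_card.
rewrite (eq_bigl (fun p => predT p.1 && (p.2 \in nbr E p.1))); last first.
  by case=> j k'; rewrite /= inE.
rewrite -(pair_big_dep predT (fun j => mem (nbr E j)) (fun _ _ => 1)) /=.
by apply: leq_sum => j _; rewrite sum1_card.
Qed.

Lemma ops_rowsum F : ops (rowsum F) <= d * d.
Proof.
apply: ops_colC_le => a; rewrite (leq_trans (@ops_bigC_le _ _ _ _ _ _ 0 _)) //.
by rewrite muln1 cardT size_enum_ord.
Qed.

Lemma ops_scaled K u p : ops (scaled Gamma mu K u p) <= 4 * (d * d).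
Proof.
rewrite !ops_bind.
apply: (@leq_trans (d * 1 + (d * 1 + d * (d * 2)))); last by nia.
by rewrite !leq_add ?ops_colC_le ?ops_mxC_le.
Qed.

Lemma ops_marginal K u p : ops (marginal Gamma mu K u p) <= 5 * (d * d).
Proof.
by rewrite ops_bind (leq_trans (leq_add (ops_scaled _ _ _) (ops_rowsum _))) //;
  nia.
Qed.

Lemma ops_vsub (v w : 'cV[R]_d) : ops (vsub v w) <= d.
Proof. by rewrite -[d in _ <= d]muln1 ops_colC_le. Qed.

Lemma ops_norm1 (v : 'cV[R]_d) : ops (norm1 v) <= 2 * d.
Proof.
rewrite (leq_trans (@ops_bigC_le _ _ _ _ _ _ 1 _)) //.
by rewrite cardT size_enum_ord mulnC.
Qed.

Lemma ops_dist1 (v w : 'cV[R]_d) : ops (dist1 v w) <= 3 * d.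
Proof.
by rewrite ops_bind (leq_trans (leq_add (ops_vsub _ _) (ops_norm1 _))) //; nia.
Qed.

Lemma ops_normalize (v : 'cV[R]_d) : ops (normalize v) <= 3 * d.
Proof.
rewrite ops_bind (@leq_trans (2 * d + d * 1)) //; last by nia.
by rewrite leq_add ?ops_norm1 ?ops_colC_le.
Qed.

Lemma ops_average q j : ops (average E q j) <= 2 * (d * d) * #|nbr E j|.
Proof.
apply: (@leq_trans (d * (#|nbr E j| * 1 + 1))).
  apply: ops_colC_le => a; rewrite ops_bind leq_add //.
  exact: (@ops_bigC_le _ _ _ _ (mem (nbr E j))).
by have := nbr_neq0 j; set n := #|_|; nia.
Qed.

Lemma ops_geomean q j : ops (geomean E q j) <= 3 * (d * d) * #|nbr E j|.
Proof.
apply: (@leq_trans (d * (#|nbr E j| * 1 + 2))).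
  apply: ops_colC_le => a; rewrite ops_bind leq_add //.
  exact: (@ops_bigC_le _ _ _ _ (mem (nbr E j))).
by have := nbr_neq0 j; set n := #|_|; nia.
Qed.

Lemma ops_update_leaf K u q p : ops (update_leaf mu K u q p) <= 4 * (d * d).
Proof.
apply: (@leq_trans (d * (1 + (d * 2 + 1)))); last by nia.
apply: ops_colC_le => a; rewrite ops_bind leq_add2l; case: ifP => _.
  rewrite ops_bind leq_add // (leq_trans (@ops_bigC_le _ _ _ _ _ _ 1 _)) //.
  by rewrite cardT size_enum_ord.
by rewrite !ops_bind /=; lia.
Qed.

Lemma ops_update_inner u q (m : V -> 'cV[R]_d) p :
  ops (update_inner u q m p) <= 4 * (d * d).
Proof. by apply: (@leq_trans (d * 2)); [exact: ops_colC_le | nia]. Qed.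

Lemma ops_bis_step K S u :
  ops (bis_step E Gamma mu K S u) <= 30 * (#|E| * (d * d)).
Proof.
rewrite !ops_bind; set q := value _; set m := value _.
apply: (@leq_trans (2 * #|E| * (5 * (d * d)) +
  (6 * (d * d) * (2 * #|E|) + 2 * #|E| * (4 * (d * d))))); last by nia.
apply: leq_add.
  rewrite (leq_trans (ops_forC_le (k := 5 * (d * d)) _ _)) //.
    by move=> p _; exact: ops_marginal.
  by rewrite leq_mul2r card_arc_from_le orbT.
apply: leq_add.
  apply: sum_nbr_le => j _; rewrite ops_bind.
  rewrite (leq_trans (leq_add (ops_geomean _ _) (ops_normalize _))) //.
  by have := nbr_neq0 j; set n := #|_|; nia.
rewrite (leq_trans (ops_forC_le (k := 4 * (d * d)) _ _)) //.
  by move=> p _; case: ifP => _;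
    [exact: ops_update_leaf | exact: ops_update_inner].
by rewrite leq_mul2r card_arc_from_le orbT.
Qed.

Lemma ops_node_dist (P : pred V) q (m : V -> 'cV[R]_d) :
  ops (bigC +%R 0%R P (fun j =>
    bigC +%R 0%R (mem (nbr E j)) (fun k => dist1 (q (j, k)) (m j))))
  <= 10 * (#|E| * (d * d)).
Proof.
apply: (@leq_trans (5 * (d * d) * (2 * #|E|))); last by nia.
apply: sum_nbr_le => j _.
apply: (@leq_trans (#|nbr E j| * (3 * d).+1).+1).
  rewrite ltnS; apply: (@ops_bigC_le _ _ _ _ (mem (nbr E j))) => k _.
  exact: ops_dist1.
by have := nbr_neq0 j; set n := #|_|; nia.
Qed.

Lemma ops_mismatch K u :
  ops (mismatch E Gamma mu K u) <= 35 * (#|E| * (d * d)).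
Proof.
rewrite !ops_bind; set q := value _; set m := value _.
apply: (@leq_trans (2 * #|E| * (5 * (d * d)) + (2 * (d * d) * (2 * #|E|) +
  (10 * (#|E| * (d * d)) + (10 * (#|E| * (d * d)) + 1))))); last by nia.
apply: leq_add.
  rewrite (leq_trans (ops_forC_le (k := 5 * (d * d)) _ _)) //.
    by move=> p _; exact: ops_marginal.
  by rewrite leq_mul2r card_is_arc_le orbT.
apply: leq_add; first by apply: sum_nbr_le => j _; exact: ops_average.
by rewrite !leq_add // ops_node_dist.
Qed.

Lemma ops_gibbs_kernel (eps : R) :
  ops (gibbs_kernel E C eps) <= 6 * (#|E| * (d * d)).
Proof.
apply: (@leq_trans (2 * #|E| * (d * (d * 3)))); last by nia.
rewrite (leq_trans (ops_forC_le (k := d * (d * 3)) _ _)) //.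
  by move=> p _; exact: ops_mxC_le.
by rewrite leq_mul2r card_is_arc_le orbT.
Qed.

Lemma ops_scaled_all K u : ops (forC (is_arc E) (fun=> 0%R)
  (scaled Gamma mu K u)) <= 8 * (#|E| * (d * d)).
Proof.
apply: (@leq_trans (2 * #|E| * (4 * (d * d)))); last by nia.
rewrite (leq_trans (ops_forC_le (k := 4 * (d * d)) _ _)) //.
  by move=> p _; exact: ops_scaled.
by rewrite leq_mul2r card_is_arc_le orbT.
Qed.

Lemma ops_round_factor (t s : R) : ops (round_factor t s) <= 3.
Proof. by rewrite ops_bind; case: ifP. Qed.

Lemma ops_Round F (r c : 'cV[R]_d) : ops (Round F r c) <= 20 * (d * d).
Proof.
rewrite !ops_bind.
apply: (@leq_trans (d * d + (d * 3 + (d * (d * 1) + (d * d + (d * 3 +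
  (d * (d * 1) + (d * d + (d + (d * d + (d + (2 * d + (1 + d * (d *
    3))))))))))))));
  last by nia.
do 12!(apply: leq_add; [by rewrite ?ops_rowsum ?ops_vsub ?ops_norm1
  ?ops_mxC_le // ops_colC_le // => a; exact: ops_round_factor|]).
by case: ifP => // _; apply: ops_mxC_le.
Qed.

Lemma ops_rounding S (B : V * V -> 'M[R]_d) :
  ops (rounding E Gamma mu S B) <= 48 * (#|E| * (d * d)).
Proof.
rewrite !ops_bind; set q := value _; set m := value _.
apply: (@leq_trans (2 * #|E| * (d * d) + (2 * (d * d) * (2 * #|E|) +
  (2 * #|E| * (21 * (d * d)) + 0)))); last by nia.
apply: leq_add.
  rewrite (leq_trans (ops_forC_le (k := d * d) _ _)) //.
    by move=> p _; exact: ops_rowsum.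
  by rewrite leq_mul2r card_arc_from_le orbT.
apply: leq_add; first by apply: sum_nbr_le => j _; exact: ops_average.
apply: leq_add => //.
rewrite (leq_trans (ops_forC_le (k := 21 * (d * d)) _ _)) //.
  move=> p _; rewrite ops_bind.
  by rewrite (leq_trans (leq_add (ops_rowsum _) (ops_Round _ _ _))) //; nia.
by rewrite leq_mul2r card_arc_from_le orbT.
Qed.

End OperationCounts.

(** Turns the loop relation into plain iterates. The test follows the body, so state [n.+1] decides
    whether to continue and a halt at index [k] means [k.+1] executions. *)
Lemma repeat_until_iter (A : Type) (body : A -> counted A)
    (stop : A -> counted bool) (W k : nat) (a : A) :
  let it n := iter n (fun x => value (body x)) a in
  (forall x, (ops (body x) + ops (stop (value (body x))) <= W)%N) ->
  (forall n, (n < k)%N -> ~~ value (stop (it n.+1))) ->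
  value (stop (it k.+1)) ->
  exists r, [/\ repeat_until body stop a r, value r = it k.+1
              & (ops r <= k.+1 * W)%N].
Proof.
move=> it hW; rewrite /it => {it}; elim: k a => [|k IH] a hn hk.
  exists (let* a' := body a in let* b := stop a' in ret a').
  split=> //; first exact: RepeatHalt.
  by rewrite !ops_bind addn0 mul1n.
have [n nk||r [hr vr or]] := IH (value (body a)).
- by have := hn n.+1 nk; rewrite iterSr.
- by move: hk; rewrite iterSr.
exists (let* a' := body a in let* b := stop a' in r); split.
- by apply: RepeatAgain => //; exact: (hn 0%N).
- by rewrite iterSr -vr.
- by rewrite !ops_bind addnA mulSn leq_add.
Qed.

(** * Termination *)

Section Convergence.
Variables (R : realType) (V : finType) (E : {set V * V}) (d : nat).
Variables (Gamma : {set V}) (mu : V -> 'cV[R]_d) (C : V * V -> 'M[R]_d).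
Variables (S1 S2 : {set V}) (eps : R).

Hypothesis d_gt1 : (1 < d)%N.
Hypothesis E_tree : is_tree E.
Hypothesis Gamma_neq0 : (0 < #|Gamma|)%N.
Hypothesis Gamma_leaves : nonadjacent_leaves E Gamma.
Hypothesis mu_prob : forall j, j \in Gamma -> is_prob (mu j).
Hypothesis C_rev : forall p, is_arc E p -> C (rev_arc p) = (C p)^T.
Hypothesis S_bip : is_bipartition E S1 S2.
Hypothesis eps_gt0 : 0 < eps.

Let d_gt0 : (0 < d)%N := ltnW d_gt1.
Let E_asym : forall j k, (j, k) \in E -> (k, j) \notin E.
Proof. by case: E_tree. Qed.
Let Gamma_nonadj :
  forall j k, j \in Gamma -> k \in Gamma -> ~~ adj E j k.
Proof. by case: Gamma_leaves. Qed.

Local Notation K := (gibbs E C eps).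
Local Notation kap := (Cinf E C / eps).
Local Notation side := (side S1 S2).

Let kap_ge0 : 0 <= kap.
Proof. by rewrite divr_ge0 ?Cinf_ge0 // ltW. Qed.

Let K_rev := gibbs_rev eps C_rev.
Let K_bounds := gibbs_bounds C_rev eps_gt0.

Lemma tree_nbr_gt0 j : (0 < #|nbr E j|)%N.
Proof.
have [i iG] := card_gt0P Gamma_neq0.
have [leaf _] := Gamma_leaves.
have [_ conn _] := E_tree; have /connectP[[|k s] /= jk ij] := conn j i.
  by rewrite -ij leaf.
by apply/card_gt0P; exists k; rewrite inE; case/andP: jk.
Qed.

Lemma tree_edge_gt0 : (0 < #|E|)%N.
Proof.
have [i _] := card_gt0P Gamma_neq0; have [k] := card_gt0P (tree_nbr_gt0 i).
by rewrite inE => /orP[|] ik; apply/card_gt0P; [exists (i, k) | exists (k, i)].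
Qed.

Lemma side_cut t p : is_arc E p -> (p.1 \in side t) = (p.2 \notin side t).
Proof.
have [_ disj cut] := S_bip; move=> /cut.
have h j : j \in S1 -> (j \in S2) = false by exact: disjointFr.
have h' j : j \in S2 -> (j \in S1) = false by exact: disjointFl.
by rewrite /Defs.side; case: ifP => _ /orP[] /andP[p1 p2];
  rewrite ?p1 ?p2 ?(h _ p1) ?(h _ p2) ?(h' _ p1) ?(h' _ p2).
Qed.

Lemma side_next t j : j \notin side t.+1 -> j \in side t.
Proof.
have [cover _ _] := S_bip; have : j \in S1 :|: S2 by rewrite cover inE.
by rewrite /Defs.side finset.in_setU /=; case: (odd t) => /= /orP[] ->.
Qed.

Fixpoint iterate t : V * V -> 'cV[R]_d :=
  if t is t'.+1 then value (bis_step E Gamma mu K (side t') (iterate t'))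
  else fun=> const_mx 1.

Lemma iterate_regular t : regular E Gamma kap (iterate t).
Proof.
elim: t => [|t IH] /=; last first.
  exact: (regular_step d_gt0 mu_prob Gamma_nonadj kap_ge0 K_bounds _ IH).
split=> [p a|j _|p _]; first by rewrite mxE.
- by exists 0 => a; apply: big1 => k _; rewrite mxE ln1.
- exists 0 => a; rewrite mxE ln1 subr0 normr0 mulr_ge0 //.
Qed.

(** The all-ones start is not normalized, hence the index [t.+1]: the convergence analysis begins
    after one iteration. *)
Lemma iterate_unit_mass t : unit_mass E Gamma mu K (iterate t.+1).
Proof.
apply: (unit_mass_step d_gt0 mu_prob Gamma_nonadj K_rev K_bounds) =>
  [p Ep||p Ep].
- by rewrite (side_cut _ Ep).
- exact: iterate_regular.
- by rewrite (side_cut _ Ep) orNb.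
Qed.

(** A node outside the part updated next was updated in the iteration just completed, so its
    marginals all agree with its target. *)
Lemma iterate_fitted t p : is_arc E p -> p.1 \notin side t.+1 ->
  forall a, row_marginal Gamma mu K (iterate t.+1) p a =
            target E Gamma mu K (iterate t.+1) p.1 a.
Proof.
move=> Ep /side_next pS a.
apply: (fitted_step d_gt0 mu_prob Gamma_nonadj K_bounds (S := side t)).
- by move=> q Eq; rewrite (side_cut _ Eq).
- exact: iterate_regular.
- by rewrite /arc_from Ep.
Qed.

Local Notation mis t := (mismatch_sum E Gamma mu K (iterate t)).

Lemma mismatch_large_bound (del : R) N : 0 < Cinf E C -> 0 < del ->
  (forall t, (t < N)%N -> del < mis t.+1) ->
  N%:R <= 256 * #|E|%:R * Cinf E C / (eps * del).
Proof.
move=> C0 del0 large.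
(* By balance the dual increments depend on [nu] only through its values on [Gamma] and its unit
   mass; the uniform vector is a convenient completion. *)
pose nu j (a : 'I_d) : R := if j \in Gamma then mu j a 0 else d%:R^-1.
have nu_leaf j a : j \in Gamma -> nu j a = mu j a 0 by rewrite /nu => ->.
have nu_mass j : \sum_a nu j a = 1.
  rewrite /nu; case: (j \in Gamma) (@mu_prob j) => [/(_ isT)[]//|_].
  by rewrite sumr_const card_ord -[_ *+ _]mulr_natr mulVf // pnatr_eq0 -lt0n.
have E0 := tree_edge_gt0.
have kap0 : 0 < kap by rewrite divr_gt0.
(* In [descent_bound], [r = 4 * kap] comes from the dual gap and [A = 16 * #|E|] from the
   increase. *)
have -> : 256 * #|E|%:R * Cinf E C / (eps * del) =
    4 * (4 * kap) * (16 * #|E|%:R) / del.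
  by field; rewrite !lt0r_neq0.
apply: (@descent_bound R (fun t => dual E nu (iterate t.+1)) (fun t =>
  mis t.+1)).
- by rewrite mulr_gt0.
- by rewrite mulr_gt0 // ltr0n.
- exact: del0.
move=> t tN; split; first exact/ltW/large.
- apply: (mismatch_sqr_le d_gt0 E_asym mu_prob Gamma_nonadj K_bounds) => //.
  + by move=> q Eq; rewrite (side_cut _ Eq).
  + exact: iterate_regular.
  + exact: iterate_unit_mass.
  + by move=> p Ep pS a; exact: iterate_fitted.
- apply: (dual_gap E_asym mu_prob K_rev K_bounds) => //;
    [exact: iterate_regular|exact: iterate_regular|exact:
      iterate_unit_mass|exact: iterate_unit_mass].
Qed.

(** A run that never stopped would make the bound hold for every [N], against the Archimedean
    property; the least stopping index then inherits the bound. *)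
Lemma scaling_terminates (del : R) : 0 < Cinf E C -> 0 < del ->
  exists k, [/\ mis k.+1 <= del, forall t, (t < k)%N -> del < mis t.+1
    & k%:R <= 256 * #|E|%:R * Cinf E C / (eps * del)].
Proof.
move=> C0 del0; have bound := mismatch_large_bound C0 del0.
have ex : exists k, mis k.+1 <= del.
  apply: contrapT => /forallNP no.
  set b : R := 256 * #|E|%:R * Cinf E C / (eps * del).
  have b0 : 0 <= b by rewrite divr_ge0 ?mulr_ge0 // ltW.
  have := archi_boundP b0; rewrite ltNge => /negP[]; apply: bound => t _.
  by rewrite ltNge; apply/negP/no.
case: (ex_minnP ex) => k hk kmin; exists k.
have large t : (t < k)%N -> del < mis t.+1.
  by move=> tk; rewrite ltNge; apply: contraL tk => /kmin; rewrite -leqNgt.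
by split=> //; exact: bound.
Qed.

Lemma scaling_then_rounding_exists (del : R) : 0 < Cinf E C -> 0 < del ->
  exists res k, [/\
    scaling_then_rounding E Gamma mu C S1 S2 eps del res,
    mis k.+1 <= del,
    value res = value (rounding E Gamma mu (side k.+1)
      (value (forC (is_arc E) (fun=> 0) (scaled Gamma mu K (iterate k.+1))))),
    k%:R <= 256 * #|E|%:R * Cinf E C / (eps * del)
    & (ops res <= k.+2 * (66 * (#|E| * (d * d))))%N].
Proof.
move=> C0 del0; have [k [hk large kb]] := scaling_terminates C0 del0.
have E0 := tree_edge_gt0; have N0 := tree_nbr_gt0.
pose body := iteration E Gamma mu S1 S2 K.
pose stop := stop_test E Gamma mu K del.
pose it n := iter n (fun x => value (body x)) (0%N, fun=> const_mx 1).
have itE n : it n = (n, iterate n).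
  elim: n => [|n IH]; first by [].
  have -> : it n.+1 = value (body (it n)) by exact: iterS.
  by rewrite IH.
have stopE n : value (stop (it n)) = (mis n <= del).
  by rewrite itE -mismatchE.
have [||| r [hr vr or]] := @repeat_until_iter _ body stop
    (66 * (#|E| * (d * d))) k (0%N, fun=> const_mx 1).
(* Per iteration: 30 units for the update, 35 for the mismatch, and one for the comparison, itself
   at most [#|E| * (d * d)]. *)
- move=> [n v]; rewrite (_ : 66 = 30 + 36)%N // mulnDl leq_add //.
    by rewrite ops_bind addn0 ops_bis_step.
  rewrite ops_bind (_ : 36 = 35 + 1)%N // mulnDl leq_add ?ops_mismatch //.
  by rewrite mul1n !muln_gt0 E0 d_gt0.
- by move=> n nk; rewrite -/(it n.+1) stopE -ltNge large.
- by rewrite -/(it k.+1) stopE.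
pose out := let* K0 := gibbs_kernel E C eps in let* tu := r in
  let* B := forC (is_arc E) (fun=> 0) (scaled Gamma mu K0 tu.2) in ret (tu.1,
    B).
have rE : value r = (k.+1, iterate k.+1) := etrans vr (itE k.+1).
exists (let* tB := out in rounding E Gamma mu (side tB.1) tB.2), k.
split; [by exists out; [exists r|] | exact: hk | | exact: kb |].
  rewrite -[LHS]/(value (rounding E Gamma mu (side (value r).1)
    (value (forC (is_arc E) (fun=> 0) (scaled Gamma mu K (value r).2))))).
  by rewrite rE.
rewrite /out !ops_bind.
(* Kernel, output matrices and rounding take [6 + 8 + 48] units, less than one further iteration;
   this accounts for [k.+2]. *)
apply: (@leq_trans (6 * (#|E| * (d * d)) + (k.+1 * (66 * (#|E| * (d * d))) +
  (8 * (#|E| * (d * d)) + 0)) + 48 * (#|E| * (d * d)))); last by lia.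
apply: leq_add; last exact: ops_rounding.
apply: leq_add; first exact: ops_gibbs_kernel.
apply: leq_add; first exact: or.
by apply: leq_add => //; exact: ops_scaled_all.
Qed.

End Convergence.

(** The stated bound tends to 0 as [delta] grows, whereas a run always executes at least one
    iteration. The operation count is therefore stated for [delta] at most a fixed multiple [kappa]
    of [|E| Cinf], the scale of the objective; the approximation holds for all [delta > 0]. *)
Theorem theorem3p11 (R : realType) (kappa : R) (kappa_gt0 : 0 < kappa) :
  exists2 c : R, 0 < c &
    forall (V : finType) (E : {set V * V}) (d : nat) (Gamma : {set V})
      (mu : V -> 'cV[R]_d) (C : V * V -> 'M[R]_d) (S1 S2 : {set V})
      (delta : R),
    is_tree E ->
    (1 < d)%N ->
    (0 < #|Gamma|)%N ->
    nonadjacent_leaves E Gamma ->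
    (forall j, j \in Gamma -> is_prob (mu j)) ->
    (forall p, is_arc E p -> C (rev_arc p) = (C p)^T) ->
    0 < Cinf E C ->
    is_bipartition E S1 S2 ->
    0 < delta ->
    exists res : counted (V * V -> 'M[R]_d),
      [/\ scaling_then_rounding E Gamma mu C S1 S2
            (delta / (4 * #|E|%:R * ln d%:R))
            (delta / (8 * Cinf E C)) res,
          approx_solution E Gamma mu C delta (value res)
        & delta <= kappa * #|E|%:R * Cinf E C ->
          (ops res)%:R <=
            c * (#|E|%:R ^+ 3 * Cinf E C ^+ 2 * d%:R ^+ 2 * ln d%:R
                 / delta ^+ 2)].
Proof.
have ln2 : 0 < ln 2 :> R by rewrite ln_gt0 // ltr1n.
(* The factor [32 = 4 * 8] comes from the denominators of [eps] and [delta']. The second summand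
   absorbs the two extra units of [k.+2], using [delta <= kappa |E| Cinf] and [ln 2 <= ln d]. *)
exists (66 * (256 * 32 + 2 * kappa ^+ 2 / ln 2)).
  by rewrite mulr_gt0 // addr_gt0 // divr_gt0 // mulr_gt0 // exprn_gt0.
move=> V E d Gamma mu C S1 S2 delta E_tree d1 G0 leaves mu_prob C_rev C0 S_bip
  delta0.
have E0 : 0 < #|E|%:R :> R.
  by rewrite ltr0n (tree_edge_gt0 E_tree G0 leaves).
have lnd2 : ln 2 <= ln d%:R :> R by rewrite ler_ln ?posrE ?ltr0n ?ler_nat //
  ltnW.
have lnd := lt_le_trans ln2 lnd2.
set eps := delta / (4 * #|E|%:R * ln d%:R); set del := delta / (8 * Cinf E C).
have eps0 : 0 < eps by rewrite divr_gt0 // !mulr_gt0.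
have del0 : 0 < del by rewrite divr_gt0 // mulr_gt0.
have [res [k [hres hk vres kb ob]]] := scaling_then_rounding_exists d1 E_tree G0
  leaves mu_prob C_rev S_bip eps0 C0 del0.
have reg : regular E Gamma (Cinf E C / eps) (iterate E Gamma mu C S1 S2 eps
  k.+1).
  exact: iterate_regular.
exists res; split; first exact: hres.
  rewrite vres; apply: rounding_approx => //.
  - by move=> p Ep; exact: (side_cut S_bip).
  - by case: reg.
  - exact: iterate_unit_mass.
  - by move=> p Ep pS a; exact: iterate_fitted.
  apply: (@le_trans _ _ (2 * eps * #|E|%:R * ln d%:R + 3 * Cinf E C * del)).
    by rewrite lerD2l ler_wpM2l // mulr_ge0 // ltW.
  (* The parameters spend half of [delta] on the entropy and three eighths on the mismatch. *)
  have -> : 2 * eps * #|E|%:R * ln d%:R + 3 * Cinf E C * del =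
      delta / 2 + 3 / 8 * delta by rewrite /eps /del; field; rewrite !lt0r_neq0.
  by lra.
move=> hdelta.
set X := #|E|%:R ^+ 2 * Cinf E C ^+ 2 * ln d%:R / delta ^+ 2.
have kX : k%:R <= 256 * 32 * X.
  apply: (le_trans kb); rewrite le_eqVlt; apply/orP; left; apply/eqP.
  by rewrite /X /eps /del; field; rewrite !lt0r_neq0.
have twoX : 2 <= 2 * kappa ^+ 2 / ln 2 * X.
  have sq : delta ^+ 2 <= (kappa * #|E|%:R * Cinf E C) ^+ 2.
    by rewrite ler_sqr // nnegrE ?mulr_ge0 // ltW.
  rewrite /X (_ : _ * _ = 2 * ((kappa * #|E|%:R * Cinf E C) ^+ 2 / delta ^+ 2) *
    (ln d%:R / ln 2)); last by field; rewrite !lt0r_neq0.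
  rewrite -mulrA ler_peMr // -[1]mulr1 ler_pM // ler_pdivlMr ?mul1r //.
  exact: exprn_gt0.
apply: (@le_trans _ _ (k.+2 * (66 * (#|E| * (d * d))))%:R);
  first by rewrite ler_nat.
rewrite !natrM (_ : 66 * _ * _ = (256 * 32 * X + 2 * kappa ^+ 2 / ln 2 * X) *
  (66 * (#|E|%:R * (d%:R * d%:R)))); last first.
  by rewrite /X; field; rewrite !lt0r_neq0.
rewrite ler_wpM2r ?mulr_ge0 ?ler0n // -addn2 natrD lerD //.
Qed.
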